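(* Let $w\in\mathcal W$. If the Dirichlet series $g(s)=\sum_{n\ge2}b_nn^{-s}$ is not $0$, then $T_g:\mathcal H^2_w\to\mathcal H^2_w$ is not in the Schatten class $\mathcal S_p$, for any $0<p<\infty$.
   Context: Weights: $w=(w_n)_{n\ge1}$ belongs to $\mathcal W$ if, for some real $\beta>0$, either $w_n=[d(n)]^\beta$ for all $n$ ($d(n)$ the number of divisors of $n$), or $w_n=d_{\beta+1}(n)$ for all $n$, where $\zeta(s)^\gamma=\sum_{n\ge1}d_\gamma(n)n^{-s}$. $\mathcal H^2_w$ is the Hilbert space of Dirichlet series $f(s)=\sum_{n\ge1}a_n n^{-s}$ with $\|f\|_{\mathcal H^2_w}^2=\sum_{n\ge1}|a_n|^2/w_n<\infty$. Volterra operator: $T_gf(s)=-\int_s^{+\infty}f(u)g'(u)\,du$, $\Re s>1/2$; in terms of coefficients, if $f=\sum a_nn^{-s}$ and $g=\sum b_nn^{-s}$, then $T_gf(s)=\sum_{n\ge2}\frac1{\log n}\big(\sum_{k\mid n,\,k<n}a_k b_{n/k}\log(n/k)\big)n^{-s}$. The Schatten class $\mathcal S_p$ consists of the compact operators whose sequence of singular values is in $\ell^p$. *)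

(* Defs.v *)
From mathcomp Require Import all_boot all_order all_algebra.
From mathcomp Require Import all_classical all_reals all_analysis.
From mathcomp Require Export complex.

Set Implicit Arguments.
Unset Strict Implicit.
Unset Printing Implicit Defensive.

Import Order.TTheory GRing.Theory Num.Theory.
Import numFieldNormedType.Exports.

Local Open Scope classical_set_scope.
Local Open Scope ring_scope.
Local Open Scope complex_scope.

Definition zeta (R : realType) (s : R) : R :=
  limn (series (fun k : nat => k.+1%:R `^ (- s))).

(* [c] is the sequence (d_gamma(n))_{n >= 1} given by
     zeta(s)^gamma = sum_{n >= 1} d_gamma(n) n^{-s}.
   Real s > 1 are enough, since a Dirichlet series is determined by its values
   on a half-line; [c 0] is not constrained. *)
Definition zeta_power_coefs (R : realType) (gamma : R) (c : nat -> R) : Prop :=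
  forall s : R, 1 < s ->
    series (fun k : nat => c k.+1 * k.+1%:R `^ (- s)) @ \oo
      --> zeta s `^ gamma.

Definition weight_class (R : realType) (w : nat -> R) : Prop :=
  exists2 beta : R, 0 < beta &
    (forall n : nat, (0 < n)%N -> w n = (size (divisors n))%:R `^ beta) \/
    zeta_power_coefs (beta + 1) w.

(* A Dirichlet series sum_{n >= 1} a_n n^{-s} is represented by its
   coefficients [a : nat -> R[i]].  The index 0 carries no information, so
   membership in the space forces [a 0 = 0], making the representation
   faithful. *)
Definition H2 (R : realType) (w : nat -> R) : set (nat -> R[i]) :=
  [set a | a 0%N = 0 /\
    (\sum_(1 <= n <oo) (complex.Re `|a n| ^+ 2 / w n)%R%:E < +oo)%E].

(* Note that [`|z|] lives in R[i], hence the real part. *)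
Definition H2norm (R : realType) (w : nat -> R) (a : nat -> R[i]) : R :=
  Num.sqrt (fine (\sum_(1 <= n <oo) (complex.Re `|a n| ^+ 2 / w n)%R%:E)).

(* sum_{n >= 1} x_n (y_n)^* / w_n, the complex series being summed
   componentwise. *)
Definition H2inner (R : realType) (w : nat -> R) (x y : nat -> R[i]) : R[i] :=
  let t n := x n.+1 * (y n.+1)^*%C in
  limn (series (fun n => complex.Re (t n) / w n.+1))
  +i* limn (series (fun n => complex.Im (t n) / w n.+1)).

Definition linear_on_H2 (R : realType) (w : nat -> R)
    (T : (nat -> R[i]) -> (nat -> R[i])) : Prop :=
  (forall x, H2 w x -> H2 w (T x)) /\
  (forall (c : R[i]) x y, H2 w x -> H2 w y ->
     T (fun n => c * x n + y n) = (fun n => c * T x n + T y n)).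

Definition compact_on_H2 (R : realType) (w : nat -> R)
    (T : (nat -> R[i]) -> (nat -> R[i])) : Prop :=
  linear_on_H2 w T /\
  forall u : nat -> (nat -> R[i]),
    (forall k, H2 w (u k) /\ H2norm w (u k) <= 1) ->
    exists (phi : nat -> nat) (y : nat -> R[i]),
      [/\ forall k, (phi k < phi k.+1)%N, H2 w y &
          (fun k => H2norm w (fun n => T (u (phi k)) n - y n)) @ \oo
            --> (0 : R)].

(* z = T^* y *)
Definition is_adjoint_value (R : realType) (w : nat -> R)
    (T : (nat -> R[i]) -> (nat -> R[i])) (y z : nat -> R[i]) : Prop :=
  H2 w z /\ forall x, H2 w x -> H2inner w (T x) y = H2inner w x z.

(* ker (T^* T - lambda) *)
Definition gram_eigenspace (R : realType) (w : nat -> R)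
    (T : (nat -> R[i]) -> (nat -> R[i])) (lambda : R) : set (nat -> R[i]) :=
  [set x | H2 w x /\
     is_adjoint_value w T (T x) (fun n => lambda%:C * x n)].

Definition has_dim (R : realType) (E : set (nat -> R[i])) (m : nat) : Prop :=
  exists e : 'I_m -> (nat -> R[i]),
    [/\ forall i, E (e i),
        forall c : 'I_m -> R[i],
          (forall n, \sum_(i < m) c i * e i n = 0) -> forall i, c i = 0 &
        forall x, E x ->
          exists c : 'I_m -> R[i], forall n, x n = \sum_(i < m) c i * e i n].

(* The nonincreasing sequence of the singular values of T, i.e. of the square
   roots of the eigenvalues of T^* T, each t > 0 being repeated according to
   the multiplicity of t^2.  The sequence is padded with zeros when T has
   finite rank. *)
Definition singular_values (R : realType) (w : nat -> R)
    (T : (nat -> R[i]) -> (nat -> R[i])) (s : nat -> R) : Prop :=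
  [/\ forall n, 0 <= s n,
      forall n, s n.+1 <= s n &
      forall t : R, 0 < t ->
        exists2 m : nat, ([set n | s n = t] #= `I_m)%card &
          has_dim (gram_eigenspace w T (t ^+ 2)) m].

Definition schatten (R : realType) (w : nat -> R) (p : R)
    (T : (nat -> R[i]) -> (nat -> R[i])) : Prop :=
  compact_on_H2 w T /\
  exists2 s : nat -> R, singular_values w T s &
    cvgn (series (fun n => s n `^ p)).

(* T_g f in terms of the coefficients [b] of g and [a] of f.  The sum is empty
   for n = 0 and n = 1. *)
Definition volterra (R : realType) (b a : nat -> R[i]) : nat -> R[i] :=
  fun n => ((ln (n%:R : R))^-1)%:C *
    \sum_(1 <= k < n | (k %| n)%N)
      a k * b (n %/ k)%N * (ln ((n %/ k)%N%:R : R))%:C.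

(* Main.v *)
Require Import Defs.
From mathcomp Require Import all_boot all_order all_algebra.
From mathcomp Require Import all_classical all_reals all_analysis.
From mathcomp Require Import complex ring lra.

(** Let S_N be the set of the N integers k = 1 + m (N + j), j < N, where m is
    a fixed index with b_m <> 0.  If k and k' are in S_N and k' divides m k,
    then k' divides k, because k' is prime to m; since no element of S_N is
    twice as large as another, k' = k.  Hence, for a Dirichlet polynomial
    f = sum a_k k^{-s} with frequencies in S_N, the coefficient of T_g f at m k
    is the single term a_k b_m log m / log (m k).  The weights satisfy
    w(m k) = w(m) w(k) when k is prime to m, so
      |T_g f| >= d_N |f|   with   d_N = C / log (2 m^2 N)
    on an N-dimensional space ([volterra_poly_lower_bound]).  By the min-max
    principle the first N singular values are at least d_N, whence
    sum s_n^p >= N d_N^p, which is unbounded in N ([log_power_unbounded]).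

    Two ingredients have to be established.

    - The min-max inequality ([singular_value_lower_bound]).  If s_(N-1) < d_N,
      the eigenspaces of T^* T for the eigenvalues >= d_N^2 have total dimension
      less than N, so some nonzero test function is orthogonal to all of them.
      On their orthogonal complement W, |T x|^2 / |x|^2
      attains its supremum mu >= d_N^2 ([compact_attains_norm]): if (x_k) is a
      maximizing sequence in the unit ball and (T x_k) converges, the
      parallelogram identity in the source and in the target shows that (x_k)
      is a Cauchy sequence.  A maximizer is isotropic for the semidefinite form
      mu <x, y> - <T x, T y> on W, so the Cauchy-Schwarz inequality makes it an
      eigenvector of T^* T ([maximizer_eigen]): a new one for an eigenvalue
      >= d_N^2, a contradiction.

    - Positivity of w and its multiplicativity on coprime integers.  For
      w = d^beta this is the description of the divisors of a product
      ([divisorsM_coprime]).  For w = d_(beta+1), which is given only through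
      its Dirichlet series, one takes the multiplicative function D_g with
      D_g(p^a) = g (g + 1) ... (g + a - 1) / a! and proves that
      sum D_g(n) n^{-s} = zeta(s)^g ([divisor_series_zeta_pow]).  The Vandermonde
      convolution gives D_g * D_h = D_(g+h), so that g |-> sum D_g(n) n^{-s}
      turns sums into products; it is monotone and takes the value zeta(s) at
      g = 1, and these properties leave only zeta(s)^g.  Uniqueness of
      Dirichlet coefficients ([dirichlet_series_eq0]) then identifies w
      with D_(beta+1). *)

Set Implicit Arguments.
Unset Strict Implicit.
Unset Printing Implicit Defensive.

Import Order.TTheory GRing.Theory Num.Theory.
Import numFieldNormedType.Exports.

Local Open Scope classical_set_scope.
Local Open Scope ring_scope.

(** * Multiplicative functions and Dirichlet convolution *)

(** The pair (d, e) is recovered from d e as (gcd (d e, k), gcd (d e, m)), so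
    the products are pairwise distinct. *)
Lemma divisorsM_coprime (k m : nat) : (0 < k)%N -> (0 < m)%N -> coprime k m ->
  perm_eq (divisors (k * m)) [seq (d * e)%N | d <- divisors k, e <- divisors m].
Proof.
move=> k0 m0 co.
have coE d e : d \in divisors k -> e \in divisors m ->
    gcdn (d * e) k = d /\ gcdn (d * e) m = e.
  rewrite -!dvdn_divisors // => dk em; split.
    rewrite gcdnC Gauss_gcdl; last exact: coprime_dvdr em co.
    exact/gcdn_idPr.
  rewrite gcdnC Gauss_gcdr; last by rewrite coprime_sym;
    apply: coprime_dvdl dk co.
  exact/gcdn_idPr.
apply: uniq_perm; first exact: divisors_uniq.
  apply: allpairs_uniq => [||[d e] [d' e']]; rewrite ?divisors_uniq //=.
  move=> /allpairsP [[a b] /= [ad be [-> ->]]].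
  move=> /allpairsP [[a' b'] /= [ad' be' [-> ->]]] H.
  have [h1 h2] := coE _ _ ad be; have [h1' h2'] := coE _ _ ad' be'.
  by congr pair; [rewrite -h1 -h1' H | rewrite -h2 -h2' H].
move=> x; rewrite -dvdn_divisors ?muln_gt0 ?k0 //.
apply/idP/allpairsP => [xkm|[[d e] /= [dk em ->]]]; last first.
  by move: dk em; rewrite -!dvdn_divisors // => dk em; apply: dvdn_mul.
exists (gcdn x k, gcdn x m) => /=.
rewrite -!dvdn_divisors // !dvdn_gcdr; split=> //.
apply/eqP; rewrite eqn_dvd; apply/andP; split.
  by rewrite muln_gcdr !muln_gcdl !dvdn_gcd xkm !(dvdn_mulr _ (dvdnn x),
    dvdn_mull _ (dvdnn x)).
rewrite Gauss_dvd ?dvdn_gcdl //.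
exact: coprime_dvdl (dvdn_gcdr _ _) (coprime_dvdr (dvdn_gcdr _ _) co).
Qed.

Definition multiplicative_fun (R : pzSemiRingType) (f : nat -> R) :=
  f 1%N = 1 /\ forall k m, (0 < k)%N -> (0 < m)%N -> coprime k m ->
     f (k * m)%N = f k * f m.

Lemma multiplicative_fun_ext (R : pzSemiRingType) (f g : nat -> R) :
  multiplicative_fun f -> multiplicative_fun g ->
  (forall p a, prime p -> f (p ^ a)%N = g (p ^ a)%N) ->
  forall n, (0 < n)%N -> f n = g n.
Proof.
move=> [f1 fM] [g1 gM] fg; elim/ltn_ind => n IH n0.
case: (ltnP 1 n) => [n1|]; last by case: n n0 {IH} => // -[|//] _ _;
  rewrite f1 g1.
have pp := pdiv_prime n1; have [m com nE] := pfactor_coprime pp n0.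
have m0 : (0 < m)%N by move: n0; rewrite nE muln_gt0 => /andP[].
have pa0 : (0 < pdiv n ^ logn (pdiv n) n)%N by rewrite expn_gt0 prime_gt0.
have pco : coprime m (pdiv n ^ logn (pdiv n) n) by rewrite coprime_sym coprimeXl.
have spl h :
    h (m * pdiv n ^ logn (pdiv n) n)%N = h m * h (pdiv n ^ logn (pdiv n) n)%N ->
    h n = h m * h (pdiv n ^ logn (pdiv n) n)%N :> R by rewrite -nE.
rewrite (spl f) ?fM // (spl g) ?gM // fg // IH //.
rewrite [ltnRHS]nE ltn_Pmulr // -{1}(expn0 (pdiv n)) ltn_exp2l ?prime_gt1 //.
by rewrite logn_gt0 mem_primes pp n0 pdiv_dvd.
Qed.

Definition dirichlet_conv (R : pzSemiRingType) (f g : nat -> R) (n : nat) : R :=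
  \sum_(d <- divisors n) f d * g (n %/ d)%N.

Lemma dirichlet_conv_multiplicative (R : comPzSemiRingType) (f g : nat -> R) :
  multiplicative_fun f -> multiplicative_fun g ->
  multiplicative_fun (dirichlet_conv f g).
Proof.
move=> [f1 fM] [g1 gM]; split=> [|k m k0 m0 co].
  by rewrite /dirichlet_conv (_ : divisors 1 = [:: 1%N]) // big_seq1 f1 g1 mulr1.
rewrite /dirichlet_conv (perm_big _ (divisorsM_coprime k0 m0 co)) /=.
rewrite big_allpairs_dep /= mulr_suml big_seq [RHS]big_seq.
apply: eq_bigr => d; rewrite -dvdn_divisors // => dk.
rewrite mulr_sumr big_seq [RHS]big_seq.
apply: eq_bigr => e; rewrite -dvdn_divisors // => em.
have d0 := dvdn_gt0 k0 dk; have e0 := dvdn_gt0 m0 em.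
have cod : coprime d e by apply: coprime_dvdl dk (coprime_dvdr em co).
have -> : ((k * m) %/ (d * e) = (k %/ d) * (m %/ e))%N.
  by rewrite divnMA -divn_mulAC // muln_divA.
rewrite fM // gM ?divn_gt0 ?(dvdn_leq _ dk) ?(dvdn_leq _ em) //; first by ring.
by apply: coprime_dvdl (dvdn_div dk) (coprime_dvdr (dvdn_div em) co).
Qed.

Lemma divisors_pfactor (p a : nat) : prime p ->
  perm_eq (divisors (p ^ a)) [seq (p ^ i)%N | i <- iota 0 a.+1].
Proof.
move=> pp; apply: uniq_perm; rewrite ?divisors_uniq //.
  by rewrite map_inj_uniq ?iota_uniq //; apply: expnI; apply: prime_gt1.
move=> x; rewrite -dvdn_divisors ?expn_gt0 ?prime_gt0 //.
apply/(dvdn_pfactor _ _ pp)/mapP => [[j ja ->]|[j]].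
  by exists j => //; rewrite mem_iota.
by rewrite mem_iota ltnS => /andP[_ ja] ->; exists j.
Qed.

(** * Generalized divisor functions *)

Section DivisorCoef.
Variable R : realFieldType.
Implicit Types g h : R.

(** The coefficient of x^a in (1 - x)^(-g). *)
Definition rising_coef g (a : nat) : R := \prod_(i < a) ((g + i%:R) / i.+1%:R).

Lemma rising_coefS g a :
  a.+1%:R * rising_coef g a.+1 = (g + a%:R) * rising_coef g a.
Proof. by rewrite /rising_coef big_ord_recr /= mulrC -mulrA divfK ?pnatr_eq0 //
  mulrC. Qed.

(** This is (1 - x)^(-g) (1 - x)^(-h) = (1 - x)^(-g-h).  Writing a + 1 as
    i + (a + 1 - i) in each term and absorbing the factor by [rising_coefS]
    turns the sum for a + 1 into (g + h + a) times the sum for a. *)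
Lemma rising_coef_vandermonde g h a :
  \sum_(i < a.+1) rising_coef g i * rising_coef h (a - i)%N =
  rising_coef (g + h) a.
Proof.
elim: a => [|a IH]; first by rewrite big_ord1 /rising_coef !big_ord0 mulr1.
have a0 : a.+1%:R != 0 :> R by rewrite pnatr_eq0.
apply: (mulfI a0); rewrite rising_coefS -IH mulr_sumr.
have -> : \sum_(i < a.+2) a.+1%:R * (rising_coef g i * rising_coef h (a.+1 - i)%N)
  = \sum_(i < a.+2) (i%:R * rising_coef g i) * rising_coef h (a.+1 - i)%N
   + \sum_(i < a.+2) rising_coef g i *
        ((a.+1 - i)%N%:R * rising_coef h (a.+1 - i)%N).
  rewrite -big_split /=; apply: eq_bigr => i _.
  have ia : (i <= a.+1)%N by rewrite -ltnS.
  by rewrite natrB //; ring.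
rewrite big_ord_recl mul0r mul0r add0r [X in _ + X]big_ord_recr /= subnn mul0r
  mulr0 addr0.
rewrite -big_split mulr_sumr /=; apply: eq_bigr => i _.
have ia : (i <= a)%N by rewrite -ltnS.
by rewrite /bump leq0n add1n rising_coefS subSS subSn // rising_coefS natrB //;
  ring.
Qed.

Lemma rising_coef_ge0 g a : 0 <= g -> 0 <= rising_coef g a.
Proof. by move=> g0; apply: prodr_ge0 => i _; rewrite divr_ge0 ?addr_ge0. Qed.

Lemma rising_coef_gt0 g a : 0 < g -> 0 < rising_coef g a.
Proof. by move=> g0; apply: prodr_gt0 => i _; rewrite divr_gt0 // ltr_wpDr. Qed.

Lemma rising_coef_le g h a : 0 <= g -> g <= h ->
  rising_coef g a <= rising_coef h a.
Proof.
move=> g0 gh; apply: ler_prod => i _; rewrite divr_ge0 ?addr_ge0 //=.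
by rewrite ler_wpM2r ?invr_ge0 // lerD2r.
Qed.

Lemma rising_coef1 a : rising_coef 1 a = 1.
Proof.
by apply: big1 => i _; rewrite -natr1 addrC divff // natr1 pnatr_eq0.
Qed.

Lemma rising_coef0 a : rising_coef 0 a = (a == 0%N)%:R.
Proof.
case: a => [|a]; first by rewrite /rising_coef big_ord0.
by rewrite /rising_coef big_ord_recl add0r mul0r mul0r.
Qed.

Definition divisor_coef g (n : nat) : R :=
  \prod_(p <- primes n) rising_coef g (logn p n).

Lemma divisor_coef_multiplicative g : multiplicative_fun (divisor_coef g).
Proof.
split=> [|k m k0 m0 co]; first by rewrite /divisor_coef big_nil.
have pe : perm_eq (primes (k * m)) (primes k ++ primes m).
  apply: uniq_perm; rewrite ?primes_uniq //.
    rewrite cat_uniq !primes_uniq andbT /=.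
    by move: co; rewrite coprime_has_primes.
  by move=> p; rewrite primesM // mem_cat.
rewrite /divisor_coef (perm_big _ pe) big_cat /=; congr (_ * _);
  rewrite big_seq [RHS]big_seq; apply: eq_bigr => p;
  rewrite mem_primes => /and3P[pp _ pd]; rewrite lognM //.
  rewrite (@logn_coprime p m) ?addn0 //; exact: coprime_dvdl pd co.
by rewrite (@logn_coprime p k) // coprime_sym; apply: coprime_dvdr pd co.
Qed.

Lemma divisor_coef_pfactor g p a : prime p ->
  divisor_coef g (p ^ a) = rising_coef g a.
Proof.
move=> pp; case: a => [|a]; first by rewrite /divisor_coef expn0 big_nil
  /rising_coef big_ord0.
by rewrite /divisor_coef primesX // primes_prime // big_seq1 pfactorK.
Qed.

(** Both sides are multiplicative, and at a prime power the identity is the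
    Vandermonde convolution. *)
Lemma divisor_coef_conv g h n : (0 < n)%N ->
  dirichlet_conv (divisor_coef g) (divisor_coef h) n = divisor_coef (g + h) n.
Proof.
move: n; apply: multiplicative_fun_ext.
- by apply: dirichlet_conv_multiplicative; apply: divisor_coef_multiplicative.
- exact: divisor_coef_multiplicative.
move=> p a pp; rewrite divisor_coef_pfactor // -rising_coef_vandermonde.
rewrite /dirichlet_conv (perm_big _ (divisors_pfactor a pp)) big_map.
rewrite -(big_mkord xpredT (fun i => rising_coef g i * rising_coef h (a - i)%N)).
rewrite /index_iota subn0 big_seq [RHS]big_seq; apply: eq_bigr => i.
rewrite mem_iota ltnS => /andP[_ ia].
by rewrite -expnB ?prime_gt0 // !divisor_coef_pfactor.
Qed.

Lemma divisor_coef_ge0 g n : 0 <= g -> 0 <= divisor_coef g n.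
Proof. by move=> g0; apply: prodr_ge0 => p _; apply: rising_coef_ge0. Qed.

Lemma divisor_coef_gt0 g n : 0 < g -> 0 < divisor_coef g n.
Proof. by move=> g0; apply: prodr_gt0 => p _; apply: rising_coef_gt0. Qed.

Lemma divisor_coef_le g h n : 0 <= g -> g <= h ->
  divisor_coef g n <= divisor_coef h n.
Proof.
move=> g0 gh; apply: ler_prod => p _.
by rewrite rising_coef_ge0 //= rising_coef_le.
Qed.

Lemma divisor_coef1 n : divisor_coef 1 n = 1.
Proof. by apply: big1 => p _; rewrite rising_coef1. Qed.

Lemma divisor_coef0 n : (1 < n)%N -> divisor_coef 0 n = 0.
Proof.
move=> n1; have pin : pdiv n \in primes n by rewrite pi_pdiv.
rewrite /divisor_coef (big_rem _ pin) /= rising_coef0.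
by move: pin; rewrite -logn_gt0; case: logn => // a _; rewrite mul0r.
Qed.

End DivisorCoef.

(** * Limits of real sequences *)

Section RealSequences.
Variable R : realType.
Implicit Types (u v : nat -> R) (l c : R).

Lemma cvgn_le_cst u l c : u @ \oo --> l -> (forall n, u n <= c) -> l <= c.
Proof.
by move=> ul uc; rewrite -(cvg_lim _ ul)//; apply: limr_le;
  [apply: cvgP ul|apply: nearW].
Qed.

Lemma cvgn_ge_cst u l c : u @ \oo --> l -> (forall n, c <= u n) -> c <= l.
Proof.
by move=> ul uc; rewrite -(cvg_lim _ ul)//; apply: limr_ge;
  [apply: cvgP ul|apply: nearW].
Qed.

Lemma series_mono u : (forall n, 0 <= u n) ->
  {homo series u : n m / (n <= m)%N >-> n <= m}.
Proof. by move=> u0; apply: nondecreasing_series => n _ _. Qed.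

Lemma nonneg_series_is_cvg u c : (forall n, 0 <= u n) ->
  (forall n, series u n <= c) -> cvgn (series u).
Proof.
move=> u0 uc; apply: nondecreasing_is_cvgn; first exact: series_mono.
by exists c => _ [n _ <-].
Qed.

Lemma series_le_limit u l n : (forall n, 0 <= u n) -> series u @ \oo --> l ->
  series u n <= l.
Proof.
move=> u0 ul; rewrite -(cvg_lim _ ul)//.
by apply: nondecreasing_cvgn_le; [apply: series_mono|apply: cvgP ul].
Qed.

End RealSequences.

(** * Dirichlet series *)

Section ConvolutionSums.
Variables (R : realType).
Implicit Types X Y : nat -> R.

(** Any bound M >= n may be used for the two factors: a common one for all n
    makes the order of summation exchangeable in [conv_sum_le] and
    [conv_sum_ge]. *)
Lemma sum_divisors_pairs X Y n M : (0 < n <= M)%N ->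
  \sum_(d <- divisors n) X d * Y (n %/ d)%N =
  \sum_(1 <= d < M.+1) \sum_(1 <= e < M.+1 | (d * e == n)%N) X d * Y e.
Proof.
move=> /andP[n0 nM].
transitivity (\sum_(1 <= d < M.+1 | (d %| n)%N) X d * Y (n %/ d)%N).
  rewrite -[RHS]big_filter; apply: perm_big; apply: uniq_perm.
  - exact: divisors_uniq.
  - by rewrite filter_uniq // iota_uniq.
  move=> d; rewrite mem_filter mem_index_iota -dvdn_divisors //.
  case dn: (d %| n)%N => //=; symmetry.
  by rewrite (dvdn_gt0 n0 dn) /= ltnS (leq_trans (dvdn_leq n0 dn)).
rewrite big_mkcond /= big_nat [RHS]big_nat; apply: eq_bigr => d /andP[d0 dM].
case: ifPn => [/dvdnP[e nE]|ndn]; last first.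
  rewrite big1 // => e /eqP nE; move: ndn; rewrite -nE dvdn_mulr //.
have e0 : (0 < e)%N by move: n0; rewrite nE muln_gt0 => /andP[].
rewrite {1}nE mulnK // (big_rem e) /=; last first.
  rewrite mem_index_iota e0 /= ltnS; apply: leq_trans nM.
  by rewrite nE leq_pmulr.
rewrite nE mulnC eqxx big_seq_cond big1 ?addr0 // => e' /andP[].
rewrite mem_rem_uniq ?iota_uniq // inE => /andP[ne _] /eqP.
by rewrite mulnC => /eqP; rewrite eqn_pmul2r // (negbTE ne).
Qed.

Lemma conv_sum_le X Y N : (forall n, 0 <= X n) -> (forall n, 0 <= Y n) ->
  \sum_(1 <= n < N.+1) \sum_(d <- divisors n) X d * Y (n %/ d)%N <=
  (\sum_(1 <= d < N.+1) X d) * (\sum_(1 <= e < N.+1) Y e).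
Proof.
move=> X0 Y0.
have -> : \sum_(1 <= n < N.+1) \sum_(d <- divisors n) X d * Y (n %/ d)%N =
  \sum_(1 <= d < N.+1) \sum_(1 <= e < N.+1) \sum_(1 <= n < N.+1 | (d * e ==
    n)%N) X d * Y e.
  transitivity (\sum_(1 <= n < N.+1) \sum_(1 <= d < N.+1)
     \sum_(1 <= e < N.+1 | (d * e == n)%N) X d * Y e).
    by rewrite big_nat [RHS]big_nat; apply: eq_bigr => n ?;
      apply: sum_divisors_pairs.
  rewrite exchange_big /=; apply: eq_bigr => d _.
  by rewrite (exchange_big_dep xpredT).
rewrite mulr_suml; apply: ler_sum => d _; rewrite mulr_sumr;
  apply: ler_sum => e _.
case: (boolP ((d * e)%N \in index_iota 1 N.+1)) => deN; last first.
  rewrite big_seq_cond big1 ?mulr_ge0 // => n /andP[nN /eqP nE].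
  by rewrite nE nN in deN.
rewrite (big_rem _ deN) /= eqxx big_seq_cond big1 ?addr0 // => n /andP[].
by rewrite mem_rem_uniq ?iota_uniq // inE => /andP[ne _];
  rewrite eq_sym (negbTE ne).
Qed.

(** A pair of factors at most N has a product at most N^2. *)
Lemma conv_sum_ge X Y N : (forall n, 0 <= X n) -> (forall n, 0 <= Y n) ->
  (\sum_(1 <= d < N.+1) X d) * (\sum_(1 <= e < N.+1) Y e) <=
  \sum_(1 <= n < (N * N).+1) \sum_(d <- divisors n) X d * Y (n %/ d)%N.
Proof.
move=> X0 Y0.
have subN (F : nat -> R) : (forall n, 0 <= F n) ->
    \sum_(1 <= d < N.+1) F d <= \sum_(1 <= d < (N * N).+1) F d.
  move=> F0; rewrite [leRHS](@big_cat_nat _ _ _ N.+1) //=; last first.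
    by rewrite ltnS; case: N => // N'; rewrite leq_pmulr.
  by rewrite lerDl sumr_ge0.
have -> : \sum_(1 <= n < (N*N).+1) \sum_(d <- divisors n) X d * Y (n %/ d)%N =
  \sum_(1 <= d < (N*N).+1) \sum_(1 <= e < (N*N).+1)
     \sum_(1 <= n < (N*N).+1 | (d * e == n)%N) X d * Y e.
  transitivity (\sum_(1 <= n < (N*N).+1) \sum_(1 <= d < (N*N).+1)
     \sum_(1 <= e < (N*N).+1 | (d * e == n)%N) X d * Y e).
    by rewrite big_nat [RHS]big_nat; apply: eq_bigr => n ?;
      apply: sum_divisors_pairs.
  rewrite exchange_big /=; apply: eq_bigr => d _.
  by rewrite (exchange_big_dep xpredT).
apply: le_trans (subN _ _); last first.
  by move=> d; do 2![apply: sumr_ge0 => ? _]; rewrite mulr_ge0.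
rewrite mulr_suml big_nat [leRHS]big_nat; apply: ler_sum => d /andP[d0 dN].
apply: le_trans (subN _ _); last by move=> e; apply: sumr_ge0 => ? _;
  rewrite mulr_ge0.
rewrite mulr_sumr big_nat [leRHS]big_nat; apply: ler_sum => e /andP[e0 eN].
have deN : (d * e)%N \in index_iota 1 (N * N).+1.
  by rewrite mem_index_iota muln_gt0 d0 e0 /= ltnS leq_mul.
by rewrite (big_rem _ deN) /= eqxx lerDl sumr_ge0 // => n _; rewrite mulr_ge0.
Qed.

End ConvolutionSums.

Section DirichletSeries.
Variable R : realType.
Implicit Types (f g : nat -> R) (s : R).

Definition dirichlet_series f s : nat -> R :=
  series (fun k : nat => f k.+1 * k.+1%:R `^ (- s)).

Lemma dirichlet_seriesE f s N :
  dirichlet_series f s N = \sum_(1 <= n < N.+1) f n * n%:R `^ (- s).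
Proof. by rewrite /dirichlet_series seriesEnat /= big_add1. Qed.

Lemma eq_dirichlet_series f g s : (forall n, (0 < n)%N -> f n = g n) ->
  dirichlet_series f s = dirichlet_series g s.
Proof. by move=> fg; congr series; apply/funext => k; rewrite fg. Qed.

(** The terms are nonnegative, so the partial sums C_N of the product series
    satisfy C_N <= A_N B_N <= C_(N^2). *)
Lemma dirichlet_series_mul f g s (a b : R) :
  (forall n, 0 <= f n) -> (forall n, 0 <= g n) ->
  dirichlet_series f s @ \oo --> a -> dirichlet_series g s @ \oo --> b ->
  dirichlet_series (dirichlet_conv f g) s @ \oo --> a * b.
Proof.
move=> f0 g0 fa gb.
pose X n := f n * n%:R `^ (- s); pose Y n := g n * n%:R `^ (- s).
have X0 n : 0 <= X n by rewrite mulr_ge0 ?powR_ge0.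
have Y0 n : 0 <= Y n by rewrite mulr_ge0 ?powR_ge0.
have cE N : dirichlet_series (dirichlet_conv f g) s N =
    \sum_(1 <= n < N.+1) \sum_(d <- divisors n) X d * Y (n %/ d)%N.
  rewrite dirichlet_seriesE big_nat [RHS]big_nat; apply: eq_bigr => n /andP[n0 _].
  rewrite /dirichlet_conv mulr_suml big_seq [RHS]big_seq; apply: eq_bigr => d.
  rewrite -dvdn_divisors // => dn; rewrite /X /Y mulrACA -powRM // -natrM.
  by rewrite mulnC divnK.
have c0 n : 0 <= dirichlet_conv f g n.+1 * n.+1%:R `^ (- s).
  by rewrite mulr_ge0 ?powR_ge0 // sumr_ge0 // => d _; rewrite mulr_ge0.
have f0' n : 0 <= f n.+1 * n.+1%:R `^ (- s) by rewrite mulr_ge0 ?powR_ge0.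
have g0' n : 0 <= g n.+1 * n.+1%:R `^ (- s) by rewrite mulr_ge0 ?powR_ge0.
have cub N : dirichlet_series (dirichlet_conv f g) s N <= a * b.
  rewrite cE; apply: le_trans (conv_sum_le _ X0 Y0) _.
  have := series_le_limit N f0' fa;
    rewrite -/(dirichlet_series _ _) dirichlet_seriesE.
  have := series_le_limit N g0' gb;
    rewrite -/(dirichlet_series _ _) dirichlet_seriesE.
  by move=> hb ha; apply: ler_pM; rewrite ?sumr_ge0.
have /cvg_ex[c cc] : cvgn (dirichlet_series (dirichlet_conv f g) s).
  exact: nonneg_series_is_cvg c0 cub.
suff -> : a * b = c by [].
apply/eqP; rewrite eq_le (cvgn_le_cst cc cub) andbT.
apply: (cvgn_le_cst (cvgM fa gb)) => N /=.
rewrite !dirichlet_seriesE; apply: le_trans (conv_sum_ge _ X0 Y0) _.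
by rewrite -cE; apply: series_le_limit.
Qed.

(** Telescoping bound by the sum of 1/k - 1/(k+1). *)
Lemma series_inv_sq_le (N : nat) : \sum_(k < N) (k.+1%:R ^+ 2)^-1 <= 2 :> R.
Proof.
suff H M : \sum_(k < M.+1) (k.+1%:R ^+ 2)^-1 <= 2 - M.+1%:R^-1 :> R.
  case: N => [|N]; first by rewrite big_ord0.
  by apply: le_trans (H N) _; rewrite lerBlDr lerDl invr_ge0.
elim: M => [|M IH]; first by rewrite big_ord1 expr1n invr1; lra.
rewrite big_ord_recr /=.
have : (M.+2%:R ^+ 2)^-1 <= M.+1%:R^-1 - M.+2%:R^-1 :> R.
  rewrite -[M.+2%:R]natr1; have x0 : 0 < M.+1%:R :> R by [].
  move: M.+1%:R x0 => x x0.
  have -> : x^-1 - (x + 1)^-1 = (x * (x + 1))^-1.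
    by field; rewrite !gt_eqF // addr_gt0.
  by rewrite lef_pV2 ?posrE ?mulr_gt0 ?exprn_gt0 ?addr_gt0 // expr2 ler_pM2r
    ?addr_gt0 // lerDl.
by move=> H; apply: le_trans (lerD IH H) _; rewrite addrA subrK.
Qed.

Lemma natpow_le_inv_sq s n : 2 <= s -> n.+1%:R `^ (- s) <= (n.+1%:R ^+ 2)^-1 :> R.
Proof.
move=> s2; rewrite -powR_mulrn // -powRN ler_powR ?ler1n //; lra.
Qed.

Lemma zeta_cvg s : 2 <= s -> dirichlet_series (fun=> 1) s @ \oo --> zeta s.
Proof.
move=> s2; rewrite /zeta.
rewrite (_ : dirichlet_series _ s = series (fun k : nat => k.+1%:R `^ (- s)));
  last first.
  by congr series; apply/funext => k; rewrite mul1r.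
suff : cvgn (series (fun k : nat => k.+1%:R `^ (- s) : R)) by [].
apply: (@nonneg_series_is_cvg _ _ 2) => n; first exact: powR_ge0.
rewrite seriesEord; apply: le_trans (series_inv_sq_le n).
by apply: ler_sum => k _; apply: natpow_le_inv_sq.
Qed.

Lemma zeta_ge1 s : 2 <= s -> 1 <= zeta s.
Proof.
move=> s2; apply: (le_trans _ (series_le_limit 1 _ (zeta_cvg s2))); last first.
  by move=> n; rewrite mul1r powR_ge0.
by rewrite seriesEord /= big_ord1 mul1r powR1.
Qed.

End DirichletSeries.

(** * Real powers of the zeta function *)

Section ZetaPowers.
Variables (R : realType) (s : R).
Hypothesis s2 : 2 <= s.

Let term_ge0 (g : R) n : 0 <= g -> 0 <= divisor_coef g n.+1 * n.+1%:R `^ (- s).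
Proof. by move=> g0; rewrite mulr_ge0 ?divisor_coef_ge0 ?powR_ge0. Qed.

Lemma divisor_series_add (g h a b : R) : 0 <= g -> 0 <= h ->
  dirichlet_series (divisor_coef g) s @ \oo --> a ->
  dirichlet_series (divisor_coef h) s @ \oo --> b ->
  dirichlet_series (divisor_coef (g + h)) s @ \oo --> a * b.
Proof.
move=> g0 h0 ga hb.
rewrite -(@eq_dirichlet_series _ (dirichlet_conv (divisor_coef g) (divisor_coef
  h))).
  by apply: dirichlet_series_mul => // n; apply: divisor_coef_ge0.
move=> n; exact: divisor_coef_conv.
Qed.

Lemma divisor_series_nat n :
  dirichlet_series (divisor_coef n%:R) s @ \oo --> zeta s ^+ n.
Proof.
elim: n => [|n IH].
  rewrite expr0 -cvg_shiftS.
  rewrite (_ : [sequence _]_n = cst 1); first exact: cvg_cst.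
  apply/funext => n /=; rewrite /dirichlet_series seriesEord /= big_ord_recl.
  rewrite powR1 mulr1 (proj1 (divisor_coef_multiplicative _)) big1 ?addr0 // =>
    i _.
  by rewrite divisor_coef0 // mul0r.
rewrite -addn1 natrD exprD expr1; apply: divisor_series_add => //.
rewrite (@eq_dirichlet_series _ _ (fun=> 1)); first exact: zeta_cvg.
by move=> k _; rewrite divisor_coef1.
Qed.

Definition divisor_dirichlet_sum (g : R) : R := limn (dirichlet_series
  (divisor_coef g) s).

(** Comparison with an integer exponent above g. *)
Lemma divisor_series_cvg (g : R) : 0 <= g ->
  dirichlet_series (divisor_coef g) s @ \oo --> divisor_dirichlet_sum g.
Proof.
move=> g0; pose N := Num.bound g.
apply: (@nonneg_series_is_cvg _ _ (zeta s ^+ N)) => [n|n]; first exact: term_ge0.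
have gN : g <= N%:R by apply: ltW; apply: archi_boundP.
apply: (le_trans _ (series_le_limit n _ (@divisor_series_nat N))); last first.
  by move=> k; apply: term_ge0.
rewrite !seriesEord; apply: ler_sum => k _.
by rewrite ler_wpM2r ?powR_ge0 // divisor_coef_le.
Qed.

Let F := divisor_dirichlet_sum.

Let F_nat n : F n%:R = zeta s ^+ n.
Proof. by apply: cvg_lim => //; apply: divisor_series_nat. Qed.

Let F_mul g h : 0 <= g -> 0 <= h -> F (g + h) = F g * F h.
Proof.
by move=> g0 h0; apply: cvg_lim => //; apply: divisor_series_add => //;
  apply: divisor_series_cvg.
Qed.

Let F_le g h : 0 <= g -> g <= h -> F g <= F h.
Proof.
move=> g0 gh; have h0 := le_trans g0 gh; apply: lim_series_le => [||n].
- exact: divisor_series_cvg.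
- exact: divisor_series_cvg.
- by rewrite ler_wpM2r ?powR_ge0 // divisor_coef_le.
Qed.

Let F_exp n g : 0 <= g -> F (n%:R * g) = F g ^+ n.
Proof.
move=> g0; elim: n => [|n IH]; first by rewrite mul0r -[0]/(0%:R) F_nat !expr0.
by rewrite -addn1 natrD mulrDl mul1r F_mul ?mulr_ge0 // IH exprD expr1.
Qed.

Let F_ge1 g : 0 <= g -> 1 <= F g.
Proof.
move=> g0; have : F 0%:R <= F g by apply: F_le.
by rewrite F_nat expr0.
Qed.

(** With F(g) the sum of the series for D_g, F(n g) = F(g)^n and F is
    nondecreasing.  For a <= n g < a + 1 both n ln F(g) and n g ln zeta(s) lie
    between a ln zeta(s) and (a + 1) ln zeta(s); they differ by at most
    ln zeta(s) for every n, so ln F(g) = g ln zeta(s). *)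
Lemma divisor_series_zeta_pow (g : R) : 0 <= g ->
  dirichlet_series (divisor_coef g) s @ \oo --> zeta s `^ g.
Proof.
move=> g0; suff <- : F g = zeta s `^ g by apply: divisor_series_cvg.
have z1 := zeta_ge1 s2; have z0 : 0 < zeta s by lra.
have F0 : 0 < F g by have := F_ge1 g0; lra.
set L := ln (zeta s); have L0 : 0 <= L by rewrite ln_ge0.
suff lnF : ln (F g) = g * L by rewrite /powR gt_eqF // -/L -lnF lnK // posrE.
have main n : `|ln (F g) - g * L| * n%:R <= L.
  have ng0 : 0 <= n%:R * g by rewrite mulr_ge0.
  have /andP[] := truncn_itv ng0; set a := Num.trunc _ => lo hi.
  have zE k : ln (zeta s ^+ k) = k%:R * L by rewrite lnXn // mulr_natl.
  have FE : ln (F (n%:R * g)) = n%:R * ln (F g) by rewrite F_exp // lnXn //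
    mulr_natl.
  have h1 : a%:R * L <= n%:R * ln (F g).
    rewrite -FE -zE -F_nat ler_ln ?posrE ?F_le // ?F_nat ?exprn_gt0 //.
    by rewrite F_exp // exprn_gt0.
  have h2 : n%:R * ln (F g) <= a.+1%:R * L.
    rewrite -FE -zE -F_nat ler_ln ?posrE ?F_le // ?F_nat ?exprn_gt0 ?ltW //.
    by rewrite F_exp // exprn_gt0.
  have h3 : a%:R * L <= (n%:R * g) * L by rewrite ler_wpM2r.
  have h4 : (n%:R * g) * L <= a.+1%:R * L by rewrite ler_wpM2r // ltW.
  rewrite -[X in _ * X](@ger0_norm _ n%:R) // -normrM ler_norml.
  move: h2 h4; rewrite -natr1 => h2 h4.
  by apply/andP; split; nra.
apply/eqP; rewrite -subr_eq0 -normr_le0 leNgt; apply/negP => d0.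
have := archi_boundP (divr_ge0 L0 (ltW d0)); rewrite ltr_pdivrMr // mulrC.
by rewrite ltNge main.
Qed.

End ZetaPowers.

(** * Uniqueness of Dirichlet coefficients and the weights *)

Section DirichletUniqueness.
Variable R : realType.

(** Convergence at s = 2 gives |a_n| <= M n^2.  If a_N is the first coefficient
    not known to vanish, the remaining terms at s = 4 + j are at most
    M n^(-2) (N + 1)^(-j), so that |a_N| <= 2 M N^4 (N / (N + 1))^j for all j. *)
Lemma dirichlet_series_eq0 (a : nat -> R) :
  (forall s, 2 <= s -> dirichlet_series a s @ \oo --> 0) ->
  forall n, (0 < n)%N -> a n = 0.
Proof.
move=> a0.
have [M Mb] : exists M, forall n, (0 < n)%N -> `|a n| <= M * n%:R ^+ 2.
  have /cvg_series_cvg_0 /cvgP /cvg_has_ub [M Mb] : cvgn (dirichlet_series a 2).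
    by apply/cvg_ex; exists 0; apply: a0.
  exists M => -[//|n] _; have : `|a n.+1 * n.+1%:R `^ (- 2)| <= M by apply: Mb;
    exists n.
  rewrite normrM [X in _ * X]ger0_norm ?powR_ge0 // powRN powR_mulrn //.
  by rewrite ler_pdivrMr // exprn_gt0.
have M0 : 0 <= M by have := Mb 1%N isT; rewrite expr1n mulr1; apply: le_trans.
elim/ltn_ind => N IH N0; apply/eqP; rewrite -normr_le0.
have N0' : 0 < N%:R :> R by rewrite ltr0n.
pose r : R := N%:R / N.+1%:R.
have r0 : 0 <= r by rewrite divr_ge0.
have r1 : r < 1 by rewrite ltr_pdivrMr // mul1r ltr_nat.
suff H j : `|a N| <= 2 * M * N%:R ^+ 4 * r ^+ j.
  have cr : (fun j => 2 * M * N%:R ^+ 4 * r ^+ j) @ \oo --> 2 * M * N%:R ^+ 4 * 0.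
    by apply: cvgM; [exact: cvg_cst|apply: cvg_expr; rewrite ger0_norm].
  by have := cvgn_ge_cst cr H; rewrite mulr0.
suff H : `|a N| * N%:R `^ (- (4 + j)%:R) <= 2 * M * (N.+1%:R ^+ j)^-1.
  move: H; rewrite powRN powR_mulrn // exprD ler_pdivrMr ?mulr_gt0 ?exprn_gt0
    // => H.
  apply: le_trans H _; rewrite le_eqVlt; apply/orP; left; apply/eqP.
  by rewrite /r expr_div_n; ring.
have s2 : 2 <= (4 + j)%:R :> R by rewrite (ler_nat _ 2).
pose u k : R := a k.+1 * k.+1%:R `^ (- (4 + j)%:R).
have u0 k : (k < N.-1)%N -> u k = 0.
  by move=> kN; rewrite /u IH ?mul0r // -(prednK N0) ltnS.
have ub k : (N <= k)%N -> `|u k| <= M * (N.+1%:R ^+ j)^-1 * (k.+1%:R ^+ 2)^-1.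
  move=> Nk; rewrite /u normrM [X in _ * X]ger0_norm ?powR_ge0 // powRN
    powR_mulrn //.
  rewrite ler_pdivrMr ?exprn_gt0 //; apply: le_trans (Mb k.+1 isT) _.
  rewrite -!mulrA ler_wpM2l //.
  have -> : (k.+1%:R ^+ 2)^-1 * k.+1%:R ^+ (4 + j) = k.+1%:R ^+ 2 * k.+1%:R ^+
    j :> R.
    have k0 : k.+1%:R ^+ 2 != 0 :> R by rewrite expf_neq0.
    by rewrite -exprD (_ : 4 + j = 2 + (2 + j))%N // exprD mulrA mulVf // mul1r.
  rewrite mulrCA ler_peMr ?exprn_ge0 // mulrC ler_pdivlMr ?exprn_gt0 // mul1r.
  by rewrite lerXn2r ?nnegrE // ler_nat.
have bnd n : `|u N.-1| <= `|series u (n + N)%N| + 2 * M * (N.+1%:R ^+ j)^-1.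
  rewrite seriesEnat /= (@big_cat_nat _ _ _ N) //= ?leq_addl //.
  rewrite -{2}(prednK N0) big_nat_recr //= big_nat big1 ?add0r =>
    [|k /andP[_ kN]]; last exact: u0.
  set S := \sum_(_ <= _ < _) _.
  suff SB : `|S| <= 2 * M * (N.+1%:R ^+ j)^-1.
    have := ler_normB (u N.-1 + S) S; rewrite addrK => H; apply: le_trans H _.
    by rewrite lerD2l.
  apply: le_trans (ler_norm_sum _ _ _) _.
  apply: (@le_trans _ _ (\sum_(0 <= k < n + N) M * (N.+1%:R ^+ j)^-1 * (k.+1%:R
    ^+ 2)^-1)).
    rewrite [leRHS](@big_cat_nat _ _ _ N) //= ?leq_addl //.
    apply: (@le_trans _ _ (\sum_(N <= k < n + N) M * (N.+1%:R ^+ j)^-1 *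
      (k.+1%:R ^+ 2)^-1)).
      by rewrite big_nat [leRHS]big_nat; apply: ler_sum => k /andP[Nk _];
        apply: ub.
    by rewrite lerDr sumr_ge0 // => k _; rewrite !mulr_ge0 ?invr_ge0 ?exprn_ge0.
  rewrite -mulr_sumr big_mkord -[2 * M * _]mulrA [leRHS]mulrC.
  by rewrite ler_wpM2l ?series_inv_sq_le // mulr_ge0 // invr_ge0 exprn_ge0.
have lim0 : (fun n => `|series u (n + N)%N| + 2 * M * (N.+1%:R ^+ j)^-1) @ \oo -->
    0 + 2 * M * (N.+1%:R ^+ j)^-1.
  apply: cvgD; last exact: cvg_cst.
  rewrite -(normr0 R); apply: cvg_norm.
  have := a0 _ s2; rewrite -(cvg_shiftn N); exact.
have := cvgn_ge_cst lim0 bnd; rewrite add0r /u prednK // normrM.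
by rewrite [X in _ * X <= _]ger0_norm ?powR_ge0.
Qed.

Lemma zeta_power_coefsE (g : R) (w : nat -> R) : 0 <= g -> zeta_power_coefs g w ->
  forall n, (0 < n)%N -> w n = divisor_coef g n.
Proof.
move=> g0 hw n n0; apply/eqP; rewrite -subr_eq0; apply/eqP; move: n n0.
apply: dirichlet_series_eq0 => s s2; rewrite -(subrr (zeta s `^ g)).
have s1 : 1 < s by lra.
rewrite (_ : dirichlet_series _ s =
    dirichlet_series w s - dirichlet_series (divisor_coef g) s).
  exact: cvgB (hw s s1) (divisor_series_zeta_pow s2 g0).
apply/funext => N; rewrite !fctE !dirichlet_seriesE -sumrB.
by apply: eq_bigr => k _; rewrite mulrBl.
Qed.

Lemma weight_class_gt0 (w : nat -> R) n : weight_class w -> (0 < n)%N -> 0 < w n.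
Proof.
move=> [b b0 [wE|wz]] n0.
  rewrite wE // powR_gt0 // ltr0n; have := divisor1 n; by case: divisors.
by rewrite (zeta_power_coefsE _ wz) // ?divisor_coef_gt0 //; lra.
Qed.

Lemma weight_class_coprimeM (w : nat -> R) k m : weight_class w ->
  (0 < k)%N -> (0 < m)%N -> coprime k m -> w (k * m)%N = w k * w m.
Proof.
move=> [b b0 [wE|wz]] k0 m0 co.
  rewrite !wE ?muln_gt0 ?k0 // (perm_size (divisorsM_coprime k0 m0 co))
    size_allpairs.
  by rewrite natrM powRM.
rewrite !(zeta_power_coefsE _ wz) ?muln_gt0 ?k0 //; try lra.
by apply: (proj2 (divisor_coef_multiplicative _)).
Qed.

End DirichletUniqueness.

Local Open Scope complex_scope.

(** * Semidefinite Hermitian forms *)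

Section ComplexSquares.
Variable R : realType.
Implicit Types z : R[i].

Definition sqnorm z : R := complex.Re z ^+ 2 + complex.Im z ^+ 2.

Lemma sqnorm_ge0 z : 0 <= sqnorm z.
Proof. by rewrite addr_ge0 ?sqr_ge0. Qed.

Lemma sqnorm_eq0 z : sqnorm z <= 0 -> z = 0.
Proof.
case: z => a b; rewrite /sqnorm /= => h.
have : a ^+ 2 + b ^+ 2 == 0 by rewrite eq_le h addr_ge0 ?sqr_ge0.
by rewrite paddr_eq0 ?sqr_ge0 // !sqrf_eq0 => /andP[/eqP-> /eqP->].
Qed.

Lemma sqnorm_gt0 z : z != 0 -> 0 < sqnorm z.
Proof. by apply: contraNT; rewrite -leNgt => /sqnorm_eq0 ->. Qed.

Lemma sqnormM (z z' : R[i]) : sqnorm (z * z') = sqnorm z * sqnorm z'.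
Proof. by case: z z' => [a b] [c d]; rewrite /sqnorm /=; ring. Qed.

Lemma sqnorm_real (t : R) : sqnorm t%:C = t ^+ 2.
Proof. by rewrite /sqnorm /= expr0n addr0. Qed.

End ComplexSquares.

Section HermitianForms.
Variables (R : realType) (V : lmodType R[i]).
Implicit Types (S : set V) (B : V -> V -> R[i]) (x y z : V).

Definition lin_closed S := S 0 /\ forall c x y, S x -> S y -> S (c *: x + y).

Lemma lin_closedD S x y : lin_closed S -> S x -> S y -> S (x + y).
Proof. by move=> [_ h] Sx Sy; rewrite -[x]scale1r; apply: h. Qed.

Lemma lin_closedZ S c x : lin_closed S -> S x -> S (c *: x).
Proof. by move=> [S0 h] Sx; rewrite -[_ *: _]addr0; apply: h. Qed.

Lemma lin_closedB S x y : lin_closed S -> S x -> S y -> S (x - y).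
Proof. by move=> hS Sx Sy; rewrite -scaleN1r; apply: lin_closedD => //;
  apply: lin_closedZ. Qed.

Lemma lin_closed_sum S (I : Type) (r : seq I) (c : I -> R[i]) (v : I -> V) :
  lin_closed S -> (forall j, S (v j)) -> S (\sum_(j <- r) c j *: v j).
Proof.
move=> hS Sv; elim: r => [|j r IH]; first by rewrite big_nil; case: hS.
by rewrite big_cons; apply: (proj2 hS).
Qed.

Definition psd_form S B :=
  [/\ forall c x y z, S x -> S y -> S z -> B (c *: x + y) z = c * B x z + B y z,
      forall x y, S x -> S y -> B y x = (B x y)^*%C &
      forall x, S x -> 0 <= complex.Re (B x x)].

Definition qform B x : R := complex.Re (B x x).

Section Psd.
Variables (S : set V) (B : V -> V -> R[i]).
Hypotheses (hS : lin_closed S) (hB : psd_form S B).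
Local Notation q := (qform B).

Lemma psd_form0l z : S z -> B 0 z = 0.
Proof.
move=> Sz; have [S0 _] := hS; have [h _ _] := hB.
have := h 1 0 0 z S0 S0 Sz; rewrite scale1r addr0 mul1r => /eqP.
by rewrite -subr_eq0 opprD addrA subrr add0r oppr_eq0 => /eqP.
Qed.

Lemma psd_formDl x y z : S x -> S y -> S z -> B (x + y) z = B x z + B y z.
Proof. by have [h _ _] := hB => Sx Sy Sz;
  rewrite -[x]scale1r h // scale1r mul1r. Qed.

Lemma psd_formZl c x z : S x -> S z -> B (c *: x) z = c * B x z.
Proof.
have [h _ _] := hB; have [S0 _] := hS => Sx Sz.
by rewrite -[_ *: _]addr0 h // psd_form0l // addr0.
Qed.

Lemma psd_formBl x y z : S x -> S y -> S z -> B (x - y) z = B x z - B y z.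
Proof.
move=> Sx Sy Sz; rewrite -scaleN1r psd_formDl ?psd_formZl ?mulN1r //.
exact: lin_closedZ.
Qed.

Lemma psd_form_suml (I : Type) (r : seq I) (c : I -> R[i]) (v : I -> V) z :
  (forall j, S (v j)) -> S z ->
  B (\sum_(j <- r) c j *: v j) z = \sum_(j <- r) c j * B (v j) z.
Proof.
move=> Sv Sz; elim: r => [|j r IH]; first by rewrite !big_nil psd_form0l.
have [h _ _] := hB.
by rewrite !big_cons h ?IH //; apply: lin_closed_sum.
Qed.

Lemma psd_formC x y : S x -> S y -> B y x = (B x y)^*%C.
Proof. by case: hB => _ h _; apply: h. Qed.

Lemma psd_form0r z : S z -> B z 0 = 0.
Proof.
by move=> Sz; rewrite (@psd_formC 0) ?psd_form0l ?conjc0 //; case: hS.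
Qed.

Lemma psd_formDr x y z : S x -> S y -> S z -> B z (x + y) = B z x + B z y.
Proof.
move=> Sx Sy Sz; rewrite (psd_formC _ Sz) ?psd_formDl //; last exact: lin_closedD.
by rewrite raddfD /= -!(psd_formC _ Sz).
Qed.

Lemma psd_formZr c x z : S x -> S z -> B z (c *: x) = c^*%C * B z x.
Proof.
move=> Sx Sz; rewrite (psd_formC _ Sz) ?psd_formZl //; last exact: lin_closedZ.
by rewrite rmorphM /= -(psd_formC _ Sz).
Qed.

Lemma psd_form_diag x : S x -> B x x = (q x)%:C.
Proof.
move=> Sx; have := psd_formC Sx Sx; rewrite /qform.
case: (B x x) => a b [] /= h; congr (_ +i* _); lra.
Qed.

Lemma qform_ge0 x : S x -> 0 <= q x.
Proof. by case: hB => _ _; apply. Qed.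

Lemma qformD x y : S x -> S y -> q (x + y) = q x + q y + 2 * complex.Re (B x y).
Proof.
move=> Sx Sy; rewrite /qform psd_formDl ?psd_formDr //; try exact: lin_closedD.
by rewrite (psd_formC Sx Sy); case: (B x x) (B y y) (B x y) =>
  [??] [??] [??] /=; ring.
Qed.

Lemma qformZ c x : S x -> q (c *: x) = sqnorm c * q x.
Proof.
move=> Sx; have cSx := lin_closedZ c hS Sx.
rewrite /qform psd_formZl ?psd_formZr // psd_form_diag //.
by case: c {cSx} => a b; rewrite /sqnorm /=; ring.
Qed.

Lemma qformB x y : S x -> S y -> q (x - y) = q x + q y - 2 * complex.Re (B x y).
Proof.
move=> Sx Sy; rewrite -scaleN1r qformD ?qformZ //; last exact: lin_closedZ.
rewrite psd_formZr // /sqnorm.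
by case: (B x y) => a b /=; ring.
Qed.

Lemma qformBC x y : S x -> S y -> q (x - y) = q (y - x).
Proof. by move=> Sx Sy; rewrite !qformB // (psd_formC Sy Sx) /=;
  case: (B y x) => a b /=; ring. Qed.

Lemma parallelogram x y : S x -> S y -> q (x + y) + q (x - y) = 2 * q x + 2 * q y.
Proof. by move=> Sx Sy; rewrite qformD // qformB //; ring. Qed.

Lemma qformD_le x y : S x -> S y -> q (x + y) <= 2 * q x + 2 * q y.
Proof.
move=> Sx Sy; rewrite -parallelogram // lerDl; apply: qform_ge0;
  exact: lin_closedB.
Qed.

(** From the positivity of the form at t x + y and t x - y. *)
Lemma qform_cross (t : R) x y : 0 < t -> S x -> S y ->
  `|2 * complex.Re (B x y)| <= t * q x + t^-1 * q y.
Proof.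
move=> t0 Sx Sy; have tSx := lin_closedZ t%:C hS Sx.
have h1 := qform_ge0 (lin_closedD hS tSx Sy).
have h2 := qform_ge0 (lin_closedB hS tSx Sy).
move: h1 h2; rewrite qformD // qformB // qformZ // sqnorm_real psd_formZl //.
have -> : complex.Re (t%:C * B x y) = t * complex.Re (B x y).
  by case: (B x y) => a b /=; ring.
set c := complex.Re (B x y) => h1 h2.
have ti : t^-1 * t = 1 by rewrite mulVf // gt_eqF.
have t'0 : 0 < t^-1 by rewrite invr_gt0.
have e1 : t * q x + t^-1 * q y + 2 * c = t^-1 * (t ^+ 2 * q x + q y + 2 * (t *
  c)).
  have -> : t^-1 * (t ^+ 2 * q x + q y + 2 * (t * c)) =
    (t^-1 * t) * (t * q x + 2 * c) + t^-1 * q y by ring.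
  by rewrite ti; ring.
have e2 : t * q x + t^-1 * q y - 2 * c = t^-1 * (t ^+ 2 * q x + q y - 2 * (t *
  c)).
  have -> : t^-1 * (t ^+ 2 * q x + q y - 2 * (t * c)) =
    (t^-1 * t) * (t * q x - 2 * c) + t^-1 * q y by ring.
  by rewrite ti; ring.
have p1 : 0 <= t * q x + t^-1 * q y + 2 * c by rewrite e1 mulr_ge0 // ltW.
have p2 : 0 <= t * q x + t^-1 * q y - 2 * c by rewrite e2 mulr_ge0 // ltW.
by rewrite ler_norml; apply/andP; split; lra.
Qed.

(** The form is only semidefinite, so q y = 0 does not give y = 0; a parameter
    t in the vector t x - B(x, y) y covers the degenerate cases as well. *)
Lemma cauchy_schwarz x y : S x -> S y -> sqnorm (B x y) <= q x * q y.
Proof.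
move=> Sx Sy; set b := B x y; set n := sqnorm b.
have key (t : R) : 0 <= t ^+ 2 * q x - 2 * (t * n) + n * q y.
  have tSx := lin_closedZ t%:C hS Sx; have bSy := lin_closedZ b hS Sy.
  have := qform_ge0 (lin_closedB hS tSx bSy).
  rewrite qformB // !qformZ // sqnorm_real -/n psd_formZl // psd_formZr // -/b.
  have -> : complex.Re (t%:C * (b^*%C * b)) = t * n.
    by rewrite /n /sqnorm; case: (b) => u v /=; ring.
  by move=> h; lra.
have n0 : 0 <= n by apply: sqnorm_ge0.
have qx := qform_ge0 Sx; have qy := qform_ge0 Sy.
have [y0|yp] := eqVneq (q y) 0.
  rewrite y0 mulr0; have [x0|xp] := eqVneq (q x) 0.
    by have := key 1; rewrite x0 y0; lra.
  have xpos : 0 < q x by rewrite lt0r xp.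
  have := key (n / q x); rewrite y0 mulr0 addr0.
  have -> : (n / q x) ^+ 2 * q x - 2 * (n / q x * n) = - (n ^+ 2 / q x) by field.
  by rewrite oppr_ge0 pmulr_lle0 ?invr_gt0 // => h; nra.
have ypos : 0 < q y by rewrite lt0r yp.
have := key (q y) => h; rewrite -(ler_pM2l ypos); nra.
Qed.

End Psd.
End HermitianForms.

(** * Compact operators and the min-max inequality *)

Section Hilbert.
Variables (R : realType) (V : lmodType R[i]) (H : set V) (ip : V -> V -> R[i]).
Local Notation q := (qform ip).

Definition norm_cvg (u : nat -> V) (x : V) := forall e : R, 0 < e ->
  exists N, forall k, (N <= k)%N -> q (u k - x) <= e.

Definition norm_cauchy (u : nat -> V) := forall e : R, 0 < e ->
  exists N, forall k l, (N <= k)%N -> (N <= l)%N -> q (u k - u l) <= e.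

(** The space is a subset of an ambient vector space, because square-summable
    sequences are cut out of all sequences by a predicate. *)
Record hilbert_subspace : Prop := HilbertSubspace {
  hilbert_lin : lin_closed H;
  hilbert_psd : psd_form H ip;
  hilbert_def : forall x, H x -> q x = 0 -> x = 0;
  hilbert_complete : forall u, (forall k, H (u k)) -> norm_cauchy u ->
    exists2 x, H x & norm_cvg u x }.

Record compact_operator (T : V -> V) : Prop := CompactOperator {
  compact_stable : forall x, H x -> H (T x);
  compact_linear : forall c x y, H x -> H y -> T (c *: x + y) = c *: T x + T y;
  compact_cvg : forall u, (forall k, H (u k) /\ q (u k) <= 1) ->
    exists (phi : nat -> nat) (y : V),
      [/\ forall k, (phi k < phi k.+1)%N, H y & norm_cvg (T \o u \o phi) y] }.

Hypothesis hH : hilbert_subspace.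
Let hS := hilbert_lin hH.
Let hB := hilbert_psd hH.
Let q_ge0 x : H x -> 0 <= q x. Proof. exact: qform_ge0 hB x. Qed.

(** |u|^2 - |x|^2 = |u - x|^2 + 2 Re <u - x, x>, and the cross term is at most
    t |x|^2 + |u - x|^2 / t by [qform_cross]; t is chosen before u - x is made
    small. *)
Lemma norm_cvg_qform u x : (forall k, H (u k)) -> H x -> norm_cvg u x ->
  forall e : R, 0 < e -> exists N, forall k, (N <= k)%N -> `|q (u k) - q x| <= e.
Proof.
move=> Hu Hx ux e e0; pose t := e / (2 * (q x + 1)).
have qx := q_ge0 Hx.
have t0 : 0 < t by rewrite divr_gt0 // mulr_gt0 //; lra.
have t1 : 0 < 1 + t^-1 by rewrite addr_gt0 // invr_gt0.
have d0 : 0 < e / 2 / (1 + t^-1) by rewrite !divr_gt0.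
have [N uN] := ux _ d0; exists N => k /uN.
rewrite ler_pdivlMr // => hD.
have Hd := lin_closedB hS (Hu k) Hx.
have -> : q (u k) = q (u k - x + x) by rewrite subrK.
rewrite (qformD hS hB Hd Hx).
have ti0 : 0 < t^-1 by rewrite invr_gt0.
have := qform_cross hS hB ti0 Hd Hx; rewrite invrK => hc.
have hq : t * q x <= e / 2.
  rewrite /t mulrAC ler_pdivrMr; last by lra.
  have -> : e / 2 * (2 * (q x + 1)) = e * (q x + 1) by field.
  by rewrite ler_pM2l //; lra.
have -> : q (u k - x) + q x + 2 * complex.Re (ip (u k - x) x) - q x =
  q (u k - x) + 2 * complex.Re (ip (u k - x) x) by ring.
apply: le_trans (ler_normD _ _) _; rewrite ger0_norm ?q_ge0 //.
move: hc; set c := `|_|; nra.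
Qed.

Definition norm_closed (W : set V) := forall u x, (forall k, W (u k)) -> H x ->
  norm_cvg u x -> W x.

Section Operator.
Variable T : V -> V.
Hypothesis hT : compact_operator T.
Let TH x : H x -> H (T x). Proof. exact: compact_stable hT x. Qed.

Lemma operatorD x y : H x -> H y -> T (x + y) = T x + T y.
Proof. by move=> Hx Hy; rewrite -[x]scale1r (compact_linear hT) // !scale1r. Qed.

Lemma operator0 : T 0 = 0.
Proof.
have H0 := proj1 hS; have := operatorD H0 H0; rewrite addr0 => /eqP.
by rewrite -subr_eq0 opprD addrA subrr add0r oppr_eq0 => /eqP.
Qed.

Lemma operatorZ c x : H x -> T (c *: x) = c *: T x.
Proof.
by move=> Hx; rewrite -[_ *: x]addr0 (compact_linear hT) ?operator0 ?addr0 //;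
  case: hS.
Qed.

Lemma operatorB x y : H x -> H y -> T (x - y) = T x - T y.
Proof.
move=> Hx Hy; rewrite -scaleN1r operatorD ?operatorZ //;
  first by rewrite scaleN1r.
exact: lin_closedZ.
Qed.

Lemma qform_normalize x : H x -> q x != 0 ->
  exists2 c : R, c ^+ 2 * q x = 1 & 0 < c.
Proof.
move=> Hx qx; have q0 : 0 < q x by rewrite lt0r qx q_ge0.
exists (Num.sqrt (q x))^-1; last by rewrite invr_gt0 sqrtr_gt0.
by rewrite exprVn sqr_sqrtr ?ltW // mulVf.
Qed.

Lemma compact_bounded : exists2 M : R, 0 < M & forall x, H x ->
  q (T x) <= M * q x.
Proof.
apply: contrapT => nb.
have /choice [u hu] : forall k : nat, exists x,
    (H x /\ q x <= 1) /\ k%:R <= q (T x).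
  move=> k; apply: contrapT => nx; apply: nb; exists (k%:R + 1) => [|x Hx].
    by rewrite ltr_wpDl.
  have [q0|qn] := eqVneq (q x) 0.
    rewrite (hilbert_def hH Hx q0) operator0.
    have q00 : q 0 = 0 by rewrite /qform (psd_form0l hS hB) //; case: hS.
    by rewrite q00 mulr0.
  have [c cq c0] := qform_normalize Hx qn.
  rewrite leNgt; apply/negP => lt; apply: nx; exists (c%:C *: x).
  have Hcx := lin_closedZ c%:C hS Hx.
  rewrite operatorZ // !(qformZ hS hB) ?sqnorm_real ?cq //; last exact: TH.
  split=> //; apply: ltW.
  have qTx := q_ge0 (TH Hx).
  have c2 : 0 < c ^+ 2 by rewrite exprn_gt0.
  have : c ^+ 2 * ((k%:R + 1) * q x) < c ^+ 2 * q (T x) by rewrite ltr_pM2l.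
  by rewrite mulrCA cq; lra.
have [phi [y [phiS Hy cy]]] := compact_cvg hT (fun k => proj1 (hu k)).
have [N hN] := cy 1 ltr01.
pose K := maxn N (Num.bound (2 + 2 * q y)).
have := hN K (leq_maxl _ _); rewrite /= => hK.
have Hu k : H (T (u k)) by apply: TH; case: (hu k) => [[]].
have phi_ge k : (k <= phi k)%N.
  by elim: k => // k IH; apply: leq_ltn_trans (phiS k).
have qy := q_ge0 Hy.
have h1 := proj2 (hu (phi K)).
have h2 := qformD_le hS hB (lin_closedB hS (Hu (phi K)) Hy) Hy.
rewrite subrK in h2.
have h3 : 2 + 2 * q y < (phi K)%:R.
  have y0 : 0 <= 2 + 2 * q y by lra.
  apply: lt_le_trans (archi_boundP y0) _; rewrite ler_nat.
  by apply: leq_trans (phi_ge K); apply: leq_maxr.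
lra.
Qed.

(** Let mu be the supremum of |T x|^2 over the unit ball of W and (z_k) a
    maximizing sequence such that (T z_k) converges.  Then
      mu |z_k - z_l|^2 = 2 mu |z_k|^2 + 2 mu |z_l|^2 - mu |z_k + z_l|^2
        <= 4 mu - |T z_k + T z_l|^2
        = 4 mu - 2 |T z_k|^2 - 2 |T z_l|^2 + |T z_k - T z_l|^2,
    which tends to 0, so (z_k) itself converges; its limit is a maximizer. *)
Lemma compact_attains_norm (W : set V) (d : R) f :
  lin_closed W -> (forall x, W x -> H x) -> norm_closed W ->
  W f -> q f != 0 -> 0 < d -> d * q f <= q (T f) ->
  exists x, exists2 mu : R, d <= mu &
    [/\ W x, q x = 1, q (T x) = mu & forall h, W h -> q (T h) <= mu * q h].
Proof.
move=> hW WH Wc Wf qf d0 df.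
have [M M0 bM] := compact_bounded.
have W0 := proj1 hW.
have q00 : q 0 = 0 by rewrite /qform (psd_form0l hS hB) //; case: hS.
pose A := [set q (T h) | h in [set h | W h /\ q h <= 1]].
have A_sup : has_sup A.
  split; first by exists (q (T 0)), 0 => //=; rewrite q00 ler01.
  exists M => _ [h [Wh h1] <-]; apply: le_trans (bM _ (WH _ Wh)) _.
  by rewrite -[leRHS]mulr1 ler_wpM2l // ltW.
pose mu := sup A.
have muP h : W h -> q (T h) <= mu * q h.
  move=> Wh; have Hh := WH _ Wh.
  have [q0|qn] := eqVneq (q h) 0.
    by rewrite (hilbert_def hH Hh q0) operator0 q00 mulr0.
  have [c cq c0] := qform_normalize Hh qn.
  have c2 : 0 < c ^+ 2 by rewrite exprn_gt0.
  rewrite -(ler_pM2l c2) mulrCA cq mulr1.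
  apply: ub_le_sup; first by case: A_sup.
  exists (c%:C *: h); last by rewrite operatorZ // (qformZ hS hB) ?sqnorm_real
    //; exact: TH.
  split; first exact: lin_closedZ.
  by rewrite (qformZ hS hB) // sqnorm_real cq.
have qf0 : 0 < q f by rewrite lt0r qf q_ge0 //; apply: WH.
have dmu : d <= mu by rewrite -(ler_pM2r qf0); apply: le_trans df _; apply: muP.
have mu0 : 0 < mu by apply: lt_le_trans dmu.
have /choice [u hu] : forall k : nat, exists x, (W x /\ q x <= 1) /\ mu -
  k.+1%:R^-1 < q (T x).
  move=> k; have k0 : 0 < k.+1%:R^-1 :> R by rewrite invr_gt0.
  by have [_ [x Wx <-] lt] := sup_adherent k0 A_sup; exists x.
have [phi [y [phiS Hy cy]]] :=
  compact_cvg hT (fun k => conj (WH _ (proj1 (proj1 (hu k)))) (proj2 (proj1 (hu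
    k)))).
have phi_ge k : (k <= phi k)%N.
  by elim: k => // k IH; apply: leq_ltn_trans (phiS k).
pose z k := u (phi k).
have Wz k : W (z k) by case: (hu (phi k)) => [[]].
have Hz k : H (z k) by apply: WH.
have HTz k : H (T (z k)) by apply: TH.
have z1 k : q (z k) <= 1 by case: (hu (phi k)) => [[]].
have zmu k : mu - k.+1%:R^-1 <= q (T (z k)).
  have := ltW (proj2 (hu (phi k))); apply: le_trans.
  by rewrite lerB // lef_pV2 ?posrE // ler_nat ltnS.
have inv_small (e : R) : 0 < e -> exists N, forall k, (N <= k)%N ->
  k.+1%:R^-1 <= e.
  move=> e0; exists (Num.bound e^-1) => k Nk.
  have ei : 0 <= e^-1 by rewrite invr_ge0 ltW.
  rewrite -[e]invrK lef_pV2 ?posrE ?invr_gt0 //.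
  by apply: ltW; apply: lt_trans (archi_boundP ei) _; rewrite ltr_nat ltnS.
have zC : norm_cauchy z.
  move=> e e0; have e8 : 0 < mu * e / 8 by rewrite divr_gt0 // mulr_gt0.
  have [N1 h1] := cy _ e8; have [N2 h2] := inv_small _ e8.
  exists (maxn N1 N2) => k l; rewrite !geq_max => /andP[k1 k2] /andP[l1 l2].
  have ck := h1 k k1; have cl := h1 l l1; have mk := h2 k k2; have ml := h2 l l2.
  rewrite /= -/(z k) -/(z l) in ck cl.
  have := parallelogram hS hB (Hz k) (Hz l).
  have := parallelogram hS hB (HTz k) (HTz l).
  have := muP _ (lin_closedD hW (Wz k) (Wz l)); rewrite operatorD //.
  have := qformD_le hS hB (lin_closedB hS (HTz k) Hy) (lin_closedB hS Hy (HTz l)).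
  rewrite (qformBC hS hB Hy (HTz l)) addrA subrK.
  have := zmu k; have := zmu l.
  have m1 : mu * q (z k) <= mu by rewrite -[leRHS]mulr1 ler_pM2l.
  have m2 : mu * q (z l) <= mu by rewrite -[leRHS]mulr1 ler_pM2l.
  move=> b1 b2 b3 b4 b5 b6; rewrite -(ler_pM2l mu0).
  have -> : q (z k - z l) = 2 * q (z k) + 2 * q (z l) - q (z k + z l) by
    rewrite -b6; ring.
  rewrite mulrBr mulrDr; rewrite !(mulrCA mu 2).
  have c1 := le_trans (lerB (lexx mu) ml) b1.
  have c2 := le_trans (lerB (lexx mu) mk) b2.
  clear mk ml b1 b2; lra.
have [x Hx zx] := hilbert_complete hH Hz zC.
have Wx : W x by apply: Wc zx.
have x1 : q x <= 1.
  apply/ler_addgt0Pr => e e0; have [N hN] := norm_cvg_qform Hz Hx zx e0.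
  have := hN N (leqnn _); rewrite ler_norml => /andP[h _].
  by have := z1 N; lra.
have Tzx : norm_cvg (T \o z) (T x).
  move=> e e0; have [N hN] := zx (e / M) (divr_gt0 e0 M0).
  exists N => k /hN h; rewrite /= -operatorB //.
  apply: le_trans (bM _ (lin_closedB hS (Hz k) Hx)) _.
  by rewrite mulrC -ler_pdivlMr.
have xmu : mu <= q (T x).
  apply/ler_addgt0Pr => e e0; have e2 : 0 < e / 2 by rewrite divr_gt0.
  have [N1 h1] := norm_cvg_qform HTz (TH Hx) Tzx e2;
    have [N2 h2] := inv_small _ e2.
  have := h1 (maxn N1 N2) (leq_maxl _ _); rewrite ler_norml => /andP[_ h] /=.
  have c := le_trans (lerB (lexx mu) (h2 _ (leq_maxr N1 N2))) (zmu (maxn N1 N2)).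
  by move: h c => /=; clear; lra.
have h := muP _ Wx.
have qx := q_ge0 Hx.
have qx1 : q x = 1 by apply/eqP; rewrite eq_le x1 /= -(ler_pM2l mu0) mulr1;
  apply: le_trans h.
exists x, mu => //; split=> //.
by apply/eqP; rewrite eq_le xmu andbT; move: h; rewrite qx1 mulr1.
Qed.

(** This form measures how far a vector is from realizing the maximum. *)
Lemma psd_defect (W : set V) (mu : R) : lin_closed W -> (forall x, W x -> H x) ->
  (forall h, W h -> q (T h) <= mu * q h) ->
  psd_form W (fun a b => mu%:C * ip a b - ip (T a) (T b)).
Proof.
move=> hW WH muP; have [l _ _] := hB; split=> [c x y z Wx Wy Wz|x y Wx Wy|x Wx].
- rewrite (compact_linear hT) ?l //; try exact: WH; try exact/TH/WH.
  by ring.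
- rewrite (psd_formC hB (WH _ Wx) (WH _ Wy)) (psd_formC hB (TH (WH _ Wx)) (TH
  (WH _ Wy))).
  by rewrite rmorphB rmorphM /= oppr0.
- have := muP _ Wx; rewrite /qform;
  case: (ip x x) (ip (T x) (T x)) => [a b] [c e] /=; lra.
Qed.

(** An isotropic vector of a semidefinite form lies in its radical. *)
Lemma maximizer_eigen (W : set V) (mu : R) x : lin_closed W ->
  (forall x, W x -> H x) ->
  (forall h, W h -> q (T h) <= mu * q h) -> W x -> q (T x) = mu * q x ->
  forall h, W h -> ip (T h) (T x) = mu%:C * ip h x.
Proof.
move=> hW WH muP Wx ex h Wh.
have hD := psd_defect hW WH muP.
have := cauchy_schwarz hW hD Wh Wx.
have -> : qform (fun a b => mu%:C * ip a b - ip (T a) (T b)) x = 0.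
  move: ex; rewrite /qform; case: (ip x x) (ip (T x) (T x)) => [a b] [c e] /=;
    lra.
by rewrite mulr0 => /sqnorm_eq0/eqP; rewrite subr_eq0 => /eqP.
Qed.

End Operator.

(** The span as an intersection of subspaces: a property that defines a
    subspace passes from the vectors E_j to their span by mere instantiation. *)
Definition in_span (r : nat) (E : nat -> V) (g : V) := forall K : set V,
  lin_closed K -> (forall j, (j < r)%N -> K (E j)) -> K g.

(** Gram-Schmidt, one vector at a time; if E_r is already in the span of the
    previous vectors, their projection is kept. *)
Lemma orthogonal_decomposition r (E : nat -> V) :
  (forall j, (j < r)%N -> H (E j)) ->
  forall h, H h -> exists2 g, H g /\ in_span r E g &
    forall j, (j < r)%N -> ip (h - g) (E j) = 0.
Proof.
elim: r => [|r IH] HE h Hh.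
  exists 0 => //; split; first by case: hS.
  by move=> K [].
have HE' j : (j < r)%N -> H (E j) by move=> jr; apply: HE; apply: ltnW.
have Er := HE r (ltnSn r).
have [g [Hg sg] og] := IH HE' _ Hh.
have [gE [HgE sgE] ogE] := IH HE' _ Er.
pose e := E r - gE; have He : H e by apply: lin_closedB.
have span_orth k : H k -> (forall j, (j < r)%N -> ip k (E j) = 0) ->
    forall y, in_span r E y -> ip k y = 0.
  move=> Hk ok y sy; have [_ ] : H y /\ ip k y = 0; last by [].
  apply: (sy [set y | H y /\ ip k y = 0]) => [|j jr]; last by split;
    [apply: HE'|apply: ok].
  split=> [|c a b [Ha a0] [Hb b0]].
    by split; [case: hS|apply: psd_form0r hS hB _ Hk].
  split; first exact: (proj2 hS).
  rewrite (psd_formDr hS hB) ?(psd_formZr hS hB) // ?a0 ?b0 ?mulr0 ?addr0 //.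
  exact: lin_closedZ.
have span_up y : in_span r E y -> in_span r.+1 E y.
  by move=> sy K hK KE; apply: sy => // j jr; apply: KE; apply: ltnW.
have Hhg : H (h - g) by apply: lin_closedB.
have [q0|qe] := eqVneq (q e) 0.
  have e0 := hilbert_def hH He q0.
  have EE : E r = gE by apply/eqP; rewrite -subr_eq0 -/e e0.
  exists g; first by split=> //; apply: span_up.
  move=> j; rewrite ltnS leq_eqVlt => /orP[/eqP->|]; last exact: og.
  by rewrite EE; apply: span_orth.
pose al := ip (h - g) e / ip e e.
have ee : ip e e != 0.
  by rewrite (psd_form_diag hB He); apply/eqP => -[] /eqP; apply/negP.
have Hae : H (al *: e) by apply: lin_closedZ.
have orth_e : ip (h - (g + al *: e)) e = 0.
  rewrite opprD addrA (psd_formBl hS hB) // (psd_formZl hS hB) //.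
  by rewrite /al divfK // subrr.
have orth_j j : (j < r)%N -> ip (h - (g + al *: e)) (E j) = 0.
  move=> jr; rewrite opprD addrA (psd_formBl hS hB) // ?(psd_formZl hS hB) //;
    try exact: HE'.
  by rewrite og // ogE // mulr0 subr0.
have Hk : H (h - (g + al *: e)) by apply: lin_closedB => //; apply: lin_closedD.
exists (g + al *: e).
  split; first exact: lin_closedD.
  move=> K hK KE; apply: lin_closedD => //; first by apply: span_up.
  apply: lin_closedZ => //; apply: lin_closedB => //; first exact: KE.
  by apply: span_up.
move=> j; rewrite ltnS leq_eqVlt => /orP[/eqP->|]; last exact: orth_j.
have -> : E r = e + gE by rewrite /e subrK.
rewrite (psd_formDr hS hB) // orth_e add0r.
exact: span_orth.
Qed.

Lemma orthocomplement_lin_closed r (E : nat -> V) : (forall j, (j < r)%N ->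
  H (E j)) ->
  lin_closed [set x | H x /\ forall j, (j < r)%N -> ip x (E j) = 0].
Proof.
move=> HE; split=> [|c x y [Hx ox] [Hy oy]].
  split; first by case: hS.
  by move=> j jr; apply: psd_form0l hS hB _ (HE _ jr).
split; first exact: (proj2 hS).
move=> j jr; have [l _ _] := hB.
by rewrite l ?ox ?oy ?mulr0 ?addr0 //; apply: HE.
Qed.

Lemma orthocomplement_closed r (E : nat -> V) : (forall j, (j < r)%N ->
  H (E j)) ->
  norm_closed [set x | H x /\ forall j, (j < r)%N -> ip x (E j) = 0].
Proof.
move=> HE u x Wu Hx ux; split=> // j jr; have HEj := HE _ jr.
apply: sqnorm_eq0; apply/ler_addgt0Pr => e e0; rewrite add0r.
have qE := q_ge0 HEj.
have d0 : 0 < e / (q (E j) + 1) by rewrite divr_gt0 //; lra.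
have [N /(_ N (leqnn _)) hN] := ux _ d0.
have [Hu ou] := Wu N.
have -> : sqnorm (ip x (E j)) = sqnorm (ip (u N - x) (E j)).
  rewrite (psd_formBl hS hB) // ou // sub0r.
  by rewrite /sqnorm; case: (ip x (E j)) => a b /=; ring.
apply: le_trans (cauchy_schwarz hS hB (lin_closedB hS Hu Hx) HEj) _.
move: hN; rewrite ler_pdivlMr; last by lra.
have := q_ge0 (lin_closedB hS Hu Hx).
by move: (q (u N - x)) (q (E j)) qE => a b; nra.
Qed.

Lemma underdetermined_system (F : fieldType) n (A : 'M[F]_(n.+1, n)) :
  exists2 c : 'rV[F]_n.+1, c != 0 & c *m A = 0.
Proof.
have : kermx A != 0.
  rewrite -mxrank_eq0 mxrank_ker subn_eq0 -ltnNge.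
  by rewrite ltnS rank_leq_col.
move=> /rowV0Pn[c cA c0]; exists c => //.
exact/sub_kermxP.
Qed.

(** One half of the min-max principle.  The sequence E lists eigenvectors of
    T^* T, E k for the eigenvalue (s k)^2, which for each t > 0 have no nonzero
    eigenvector for t^2 in their orthogonal complement.  The vectors v span a
    space of dimension n + 1 on which T is bounded below by d, while
    monotonicity leaves at most n indices k with s k >= d if s n < d. *)
Lemma singular_value_lower_bound (T : V -> V) (s : nat -> R) (E : nat ->
  V) n (d : R)
    (v : 'I_n.+1 -> V) :
  compact_operator T ->
  (forall k, s k.+1 <= s k) ->
  (forall k, 0 < s k -> H (E k) /\
     forall h, H h -> ip (T h) (T (E k)) = ip h ((s k ^+ 2)%:C *: E k)) ->
  (forall t x, 0 < t -> H x ->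
     (forall h, H h -> ip (T h) (T x) = ip h ((t ^+ 2)%:C *: x)) ->
     (forall k, s k = t -> ip x (E k) = 0) -> x = 0) ->
  0 < d -> (forall j, H (v j)) ->
  (forall c : 'I_n.+1 -> R[i], \sum_j c j *: v j = 0 -> forall j, c j = 0) ->
  (forall c : 'I_n.+1 -> R[i],
     d ^+ 2 * q (\sum_j c j *: v j) <= q (T (\sum_j c j *: v j))) ->
  d <= s n.
Proof.
move=> hT sS hE spec d0 Hv freev low; rewrite leNgt; apply/negP => snd.
have s_le k l : (k <= l)%N -> s l <= s k.
  exact: ((nonincreasing_seqP s).1 sS).
(* E k is unconstrained when s k = 0; the zero vector imposes no condition. *)
pose E' k := if 0 < s k then E k else 0.
have HE' j : (j < n)%N -> H (E' j).
  by move=> _; rewrite /E'; case: ifP => [/hE[]//|_]; case: hS.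
pose W := [set x | H x /\ forall j, (j < n)%N -> ip x (E' j) = 0].
have hW : lin_closed W by apply: orthocomplement_lin_closed.
have Wc : norm_closed W by apply: orthocomplement_closed.
have WH x : W x -> H x by case.
have [c c0 cA] := underdetermined_system (\matrix_(j < n.+1, k < n) ip (v j)
  (E' k)).
pose f := \sum_j c 0 j *: v j.
have Hf : H f by apply: lin_closed_sum.
have Wf : W f.
  split=> // j jn; rewrite (psd_form_suml hS hB) //; last exact: HE'.
  have := congr1 (fun M : 'rV_n => M 0 (Ordinal jn)) cA; rewrite !mxE;
    apply: etrans.
  by apply: eq_bigr => k _; rewrite mxE.
have qf : q f != 0.
  apply: contra c0 => /eqP /(hilbert_def hH Hf) /freev h.
  by apply/eqP/rowP => j; rewrite h mxE.
have d20 : 0 < d ^+ 2 by rewrite exprn_gt0.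
have [x [mu dmu [Wx qx qTx muP]]] :=
  compact_attains_norm hT hW WH Wc Wf qf d20 (low _).
have Hx := WH _ Wx.
have mu0 : 0 < mu by apply: lt_le_trans dmu.
have exW : forall h, W h -> ip (T h) (T x) = mu%:C * ip h x.
  by apply: (maximizer_eigen hT hW WH muP Wx); rewrite qTx qx mulr1.
have TH y : H y -> H (T y) by apply: compact_stable.
(* The eigenvector identity for x defines a subspace K.  It holds on W by
   maximality, and at each E_j because both sides vanish; W and the E_j span H. *)
pose K := [set k | H k /\ ip (T k) (T x) = mu%:C * ip k x].
have hK : lin_closed K.
  have [l _ _] := hB; split=> [|a y y' [Hy ey] [Hy' ey']].
    split; first by case: hS.
    rewrite (operator0 hT) !(psd_form0l hS hB) ?mulr0 //; exact: TH.
  split; first exact: (proj2 hS).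
  rewrite (compact_linear hT) // !l // ?ey ?ey' //; try exact: TH.
  by ring.
have KE j : (j < n)%N -> K (E' j).
  move=> jn; have HEj := HE' _ jn; split=> //.
  have [_ /(_ _ jn) xE] := Wx.
  rewrite (psd_formC hB Hx HEj) xE conjc0 mulr0.
  move: HEj xE; rewrite /E'; case: ifP => [sj|_] HEj xE; last first.
    by rewrite (operator0 hT) (psd_form0l hS hB) //; apply: TH.
  have [_ /(_ x Hx) e] := hE _ sj.
  rewrite (psd_formC hB (TH _ Hx) (TH _ HEj)) e (psd_formZr hS hB) // xE.
  by rewrite mulr0 conjc0.
have ex h : H h -> ip (T h) (T x) = mu%:C * ip h x.
  move=> Hh; have [g [Hg sg] og] := orthogonal_decomposition HE' Hh.
  have Kg : K g by apply: sg.
  have Khg : K (h - g).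
    by split; [apply: lin_closedB|apply: exW; split => //; apply: lin_closedB].
  have [_] := lin_closedD hK Khg Kg.
  by rewrite subrK.
have t0 : 0 < Num.sqrt mu by rewrite sqrtr_gt0.
have x0 : x = 0.
  apply: (spec _ _ t0 Hx) => [h Hh|k sk].
    rewrite sqr_sqrtr ?ltW // ex // (psd_formZr hS hB) //.
    by congr (_ * _); rewrite /= oppr0.
  have dk : d <= s k.
    rewrite sk -(@ler_pXn2r _ 2) ?nnegrE //; try exact: ltW.
    by rewrite sqr_sqrtr //; apply: ltW.
  have kn : (k < n)%N.
    by rewrite ltnNge; apply/negP => /s_le; lra.
  by have [_ /(_ _ kn)] := Wx; rewrite /E' sk t0.
move: qx; rewrite x0 /qform (psd_form0l hS hB) /=; last by case: hS.
by move=> /eqP; rewrite eq_sym oner_eq0.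
Qed.

End Hilbert.

(** * The weighted sequence space *)

Lemma real_cauchy_cvg (R : realType) (a : nat -> R) :
  (forall e, 0 < e -> exists N, forall k l, (N <= k)%N -> (N <= l)%N ->
    `|a k - a l| <= e) ->
  cvgn a.
Proof.
move=> ac; apply: cauchy_cvg; apply: cauchy_exP => e e0.
have e2 : 0 < e / 2 by rewrite divr_gt0.
have [N hN] := ac _ e2; exists (a N); exists N => // k /= Nk.
apply: le_lt_trans (hN N k (leqnn _) Nk) _; lra.
Qed.

Section SequenceSpace.
Variables (R : realType) (w : nat -> R).
Hypothesis w0 : forall n, (0 < n)%N -> 0 < w n.
Implicit Types x y z : nat -> R[i].

Let wS n : 0 < w n.+1. Proof. exact: w0. Qed.

(** Indexed from 0 as the series are: the n-th term belongs to the coefficient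
    of (n + 1)^{-s}. *)
Definition weighted_sq x (n : nat) : R := sqnorm (x n.+1) / w n.+1.

Lemma weighted_sq_ge0 x n : 0 <= weighted_sq x n.
Proof. by rewrite divr_ge0 ?sqnorm_ge0 // ltW. Qed.

Lemma Re_norm_sq (z : R[i]) : complex.Re `|z| ^+ 2 = sqnorm z.
Proof. by rewrite normc_def /= sqr_sqrtr // addr_ge0 ?sqr_ge0. Qed.

Lemma ereal_weighted_sum x l : series (weighted_sq x) @ \oo --> l ->
  (\sum_(1 <= n <oo) (complex.Re `|x n| ^+ 2 / w n)%R%:E)%E = l%:E.
Proof.
move=> xl; apply: cvg_lim => //; rewrite -cvg_shiftS.
have := @cvg_EFin R nat \oo _ (fun n =>
  (series (weighted_sq x) n)%:E) l (nearW _ _) xl.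
rewrite (_ : [sequence _]_n = (fun n => (series (weighted_sq x) n)%:E));
  first by apply.
apply/funext => n /=; rewrite sumEFin seriesEnat /= big_add1 /=; congr (_%:E).
by apply: eq_bigr => k _; rewrite /weighted_sq -Re_norm_sq.
Qed.

Lemma H2P x : H2 w x <-> x 0%N = 0 /\ cvgn (series (weighted_sq x)).
Proof.
split=> -[x0 h]; split => //; last first.
  by rewrite (ereal_weighted_sum h) ltry.
pose S := (\sum_(1 <= n <oo) (complex.Re `|x n| ^+ 2 / w n)%R%:E)%E.
have S0 n : (0 <= n)%N -> (1 <= n)%N ->
  (0 <= (complex.Re `|x n| ^+ 2 / w n)%R%:E)%E.
  by move=> _ n1; rewrite lee_fin divr_ge0 ?sqr_ge0 // ltW // w0.
have Sge n : ((series (weighted_sq x) n)%:E <= S)%E.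
  have := @nneseries_lim_ge R (fun n =>
    (complex.Re `|x n| ^+ 2 / w n)%R%:E) xpredT 1 n.+1.
  rewrite sumEFin big_add1 /= => H; apply: le_trans (H _); last first.
    by move=> k k1 _; apply: S0.
  rewrite lee_fin !seriesEnat /= le_eqVlt; apply/orP; left; apply/eqP.
  by apply: eq_bigr => k _; rewrite /weighted_sq -Re_norm_sq.
have Sfin : S \is a fin_num.
  by rewrite ge0_fin_numE //; apply: le_trans (Sge 0%N);
    rewrite seriesEnat /= big_geq.
apply: (@nonneg_series_is_cvg _ _ (fine S)); first exact: weighted_sq_ge0.
by move=> n; rewrite -lee_fin fineK.
Qed.

Definition ip_re x y n : R := complex.Re (x n.+1 * (y n.+1)^*%C) / w n.+1.
Definition ip_im x y n : R := complex.Im (x n.+1 * (y n.+1)^*%C) / w n.+1.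

Lemma dominated_series_cvg (u v : nat -> R) : (forall n, `|u n| <= v n) ->
  cvgn (series v) -> cvgn (series u).
Proof.
move=> uv cv; apply: normed_cvg; apply: series_le_cvg cv => n //=.
exact: le_trans (uv n).
Qed.

(** From |a conj(b)| <= |a|^2 + |b|^2 in each coordinate. *)
Lemma ip_cvg x y : H2 w x -> H2 w y ->
  cvgn (series (ip_re x y)) /\ cvgn (series (ip_im x y)).
Proof.
move=> /H2P[_ hx] /H2P[_ hy].
have hs : cvgn (series (weighted_sq x + weighted_sq y)) by apply: is_cvg_seriesD.
split; apply: dominated_series_cvg hs => n;
  rewrite /ip_re /ip_im fctE /weighted_sq -mulrDl;
  rewrite normrM [X in _ * X]gtr0_norm ?invr_gt0 // ler_pM2r ?invr_gt0 //;
  case: (x n.+1) (y n.+1) => [a b] [c d]; rewrite /sqnorm /= ler_norml;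
  have := sqr_ge0 (a + c); have := sqr_ge0 (a - c); have := sqr_ge0 (b - d);
  have := sqr_ge0 (b + d); have := sqr_ge0 (a + d); have := sqr_ge0 (a - d);
  have := sqr_ge0 (b + c); have := sqr_ge0 (b - c); have := sqr_ge0 a;
    have := sqr_ge0 b;
  have := sqr_ge0 c; have := sqr_ge0 d; rewrite !expr2 => *; apply/andP; split;
    nra.
Qed.

Lemma H2inner_limit x y a b : series (ip_re x y) @ \oo --> a ->
  series (ip_im x y) @ \oo --> b -> H2inner w x y = a +i* b.
Proof. by move=> ha hb; congr (_ +i* _); apply: cvg_lim. Qed.

Lemma H2inner_cvg x y : H2 w x -> H2 w y ->
  series (ip_re x y) @ \oo --> complex.Re (H2inner w x y) /\
  series (ip_im x y) @ \oo --> complex.Im (H2inner w x y).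
Proof. by move=> hx hy; have [] := ip_cvg hx hy. Qed.

Lemma H2_qform x : H2 w x -> series (weighted_sq x) @ \oo --> qform (H2inner w) x.
Proof.
move=> hx; have [h _] := H2inner_cvg hx hx.
rewrite (_ : weighted_sq x = ip_re x x) //; apply/funext => n.
by rewrite /weighted_sq /ip_re /sqnorm; case: (x n.+1) => a b /=;
  congr (_ / _); ring.
Qed.

Lemma H2_lin_closed : lin_closed (H2 w : set (nat -> R[i])).
Proof.
split=> [|c x y /H2P[x0 hx] /H2P[y0 hy]]; apply/H2P; split=> //=.
- apply: (@nonneg_series_is_cvg _ _ 0) => n; first exact: weighted_sq_ge0.
  rewrite seriesEord /= big1 // => k _.
  by rewrite /weighted_sq /sqnorm /= expr0n /= addr0 mul0r.
- have -> : (c *: x + y) 0%N = c * x 0%N + y 0%N by [].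
  by rewrite x0 y0 mulr0 addr0.
have hs : cvgn (series ((2 * sqnorm c) *: weighted_sq x + 2 *: weighted_sq y)).
  by apply: is_cvg_seriesD; apply: is_cvg_seriesZ.
apply: series_le_cvg hs => n; first exact: weighted_sq_ge0.
  by rewrite addr_ge0 // mulr_ge0 ?weighted_sq_ge0 // mulr_ge0 ?sqnorm_ge0.
have -> : ((2 * sqnorm c) *: weighted_sq x + 2 *: weighted_sq y) n =
  2 * sqnorm c * (sqnorm (x n.+1) / w n.+1) + 2 * (sqnorm (y n.+1) / w n.+1) by
    [].
rewrite [2 * sqnorm c * _]mulrA [2 * (_ / _)]mulrA -mulrDl /weighted_sq
  ler_pM2r ?invr_gt0 //.
have -> : (c *: x + y) n.+1 = c * x n.+1 + y n.+1 by [].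
rewrite -mulrA -sqnormM; case: (c * x n.+1) (y n.+1) => [a b] [d e];
  rewrite /sqnorm /=.
have := sqr_ge0 (a - d); have := sqr_ge0 (b - e); rewrite !expr2; nra.
Qed.

Lemma H2inner_psd : psd_form (H2 w : set (nat -> R[i])) (H2inner w).
Proof.
split=> [c x y z hx hy hz|x y hx hy|x hx].
- have [xr xi] := H2inner_cvg hx hz; have [yr yi] := H2inner_cvg hy hz.
  case: c => cr ci; move: xr xi yr yi.
  case: (H2inner w x z) (H2inner w y z) => [a b] [a' b'] /= xr xi yr yi.
  have e (u v t : nat -> R) (k l : R) : (series (k *: u + l *: v + t)) =
      (fun n => k * series u n + l * series v n + series t n).
    apply/funext => n; rewrite !seriesEord /= !mulr_sumr -!big_split /=.
    by apply: eq_bigr.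
  rewrite (@H2inner_limit _ _ (cr * a + (- ci) * b + a') (cr * b + ci * a + b')).
  + by apply/eqP; rewrite eq_complex /=; apply/andP; split; apply/eqP; ring.
  + rewrite (_ : ip_re _ _ = cr *: ip_re x z + (- ci) *: ip_im x z + ip_re y z).
      rewrite e; apply: cvgD => //; apply: cvgD; apply: cvgM => //;
        exact: cvg_cst.
    apply/funext => n; rewrite /ip_re /ip_im !fctE /= /GRing.scale /=
      /GRing.scale /=.
    by case: (x n.+1) (y n.+1) (z n.+1) => [? ?] [? ?] [? ?] /=; ring.
  + rewrite (_ : ip_im _ _ = cr *: ip_im x z + ci *: ip_re x z + ip_im y z).
      rewrite e; apply: cvgD => //; apply: cvgD; apply: cvgM => //;
        exact: cvg_cst.
    apply/funext => n; rewrite /ip_re /ip_im !fctE /= /GRing.scale /=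
      /GRing.scale /=.
    by case: (x n.+1) (y n.+1) (z n.+1) => [? ?] [? ?] [? ?] /=; ring.
- have [xr xi] := H2inner_cvg hx hy.
  rewrite (@H2inner_limit _ _ (complex.Re (H2inner w x y)) (- complex.Im
    (H2inner w x y))).
  + by case: (H2inner w x y).
  + rewrite (_ : ip_re y x = ip_re x y) //; apply/funext => n.
    by rewrite /ip_re; case: (x n.+1) (y n.+1) => [? ?] [? ?] /=;
      congr (_ / _); ring.
  + rewrite (_ : ip_im y x = - ip_im x y); first by rewrite seriesN; apply: cvgN.
    apply/funext => n; rewrite fctE /ip_im -mulNr.
    by case: (x n.+1) (y n.+1) => [? ?] [? ?] /=; congr (_ / _); ring.
- apply: (cvgn_ge_cst (H2_qform hx)) => n; rewrite seriesEord /=.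
  by apply: sumr_ge0 => k _; apply: weighted_sq_ge0.
Qed.

Lemma weighted_sq_le_qform x n : H2 w x -> weighted_sq x n <= qform (H2inner w) x.
Proof.
move=> hx; apply: le_trans (series_le_limit n.+1 (weighted_sq_ge0 x) (H2_qform
  hx)).
rewrite seriesEord /= big_ord_recr /= lerDr; apply: sumr_ge0 => k _.
exact: weighted_sq_ge0.
Qed.

Lemma H2_definite x : H2 w x -> qform (H2inner w) x = 0 -> x = 0.
Proof.
move=> hx q0; apply/funext => -[|n]; first by case: hx.
apply: sqnorm_eq0; have := weighted_sq_le_qform n hx.
by rewrite q0 /weighted_sq pmulr_lle0 // invr_gt0.
Qed.

(** The usual proof for l^2: coordinatewise limits exist, and letting l tend to
    infinity in the finite partial sums of |u_k - u_l|^2 shows that they are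
    limits in norm. *)
Lemma H2_complete (u : nat -> nat -> R[i]) : (forall k, H2 w (u k)) ->
  norm_cauchy (H2inner w) u -> exists2 x, H2 w x & norm_cvg (H2inner w) u x.
Proof.
move=> hu uc.
have hS := H2_lin_closed.
have coord (n : nat) e : 0 < e -> exists N, forall k l, (N <= k)%N ->
  (N <= l)%N ->
    sqnorm (u k n.+1 - u l n.+1) <= e.
  move=> e0; have [N hN] := uc _ (divr_gt0 e0 (wS n)); exists N => k l Nk Nl.
  have := le_trans (weighted_sq_le_qform n (lin_closedB hS (hu k) (hu l))) (hN
    k l Nk Nl).
  by rewrite /weighted_sq ler_pM2r ?invr_gt0.
have abs_le (a e : R) : 0 < e -> a ^+ 2 <= e ^+ 2 -> `|a| <= e.
  by move=> e0; rewrite -real_normK ?num_real // ler_pXn2r ?nnegrE // ltW.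
have cR n : cvgn (fun k => complex.Re (u k n.+1)).
  apply: real_cauchy_cvg => e e0; have e20 : 0 < e ^+ 2 by rewrite exprn_gt0.
  have [N hN] := coord n _ e20; exists N => k l Nk Nl; apply: abs_le => //.
  apply: le_trans (hN k l Nk Nl); rewrite /sqnorm.
  by case: (u k n.+1) (u l n.+1) => [a b] [c d] /=; rewrite lerDl sqr_ge0.
have cI n : cvgn (fun k => complex.Im (u k n.+1)).
  apply: real_cauchy_cvg => e e0; have e20 : 0 < e ^+ 2 by rewrite exprn_gt0.
  have [N hN] := coord n _ e20; exists N => k l Nk Nl; apply: abs_le => //.
  apply: le_trans (hN k l Nk Nl); rewrite /sqnorm.
  by case: (u k n.+1) (u l n.+1) => [a b] [c d] /=; rewrite lerDr sqr_ge0.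
pose x n : R[i] := if n is n'.+1 then
  limn (fun k => complex.Re (u k n'.+1)) +i* limn (fun k =>
    complex.Im (u k n'.+1)) else 0.
have term_cvg k n : (fun l => weighted_sq (u k - u l) n) @ \oo --> weighted_sq
  (u k - x) n.
  have e1 y : weighted_sq (u k - y) n =
      ((complex.Re (u k n.+1) - complex.Re (y n.+1)) * (complex.Re (u k n.+1) -
        complex.Re (y n.+1))
      + (complex.Im (u k n.+1) - complex.Im (y n.+1)) * (complex.Im (u k n.+1)
        - complex.Im (y n.+1)))
      / w n.+1.
    rewrite /weighted_sq; have -> : (u k - y) n.+1 = u k n.+1 - y n.+1 by [].
    by rewrite /sqnorm; case: (u k n.+1) (y n.+1) => [a b] [c d] /=;
      congr (_ / _); ring.
  rewrite e1 (_ : (fun l => weighted_sq (u k - u l) n) = (fun l =>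
      ((complex.Re (u k n.+1) - complex.Re (u l n.+1)) * (complex.Re (u k n.+1)
        - complex.Re (u l n.+1))
      + (complex.Im (u k n.+1) - complex.Im (u l n.+1)) * (complex.Im (u k
        n.+1) - complex.Im (u l n.+1)))
      / w n.+1)); last by apply/funext => l; exact: e1.
  have dR : (fun l => complex.Re (u k n.+1) - complex.Re (u l n.+1)) @ \oo -->
     complex.Re (u k n.+1) - complex.Re (x n.+1) by apply: cvgB;
       [exact: cvg_cst|exact: cR].
  have dI : (fun l => complex.Im (u k n.+1) - complex.Im (u l n.+1)) @ \oo -->
     complex.Im (u k n.+1) - complex.Im (x n.+1) by apply: cvgB;
       [exact: cvg_cst|exact: cI].
  by apply: cvgM; [apply: cvgD; apply: cvgM|exact: cvg_cst].
have sum_cvg k M : (fun l => series (weighted_sq (u k - u l)) M) @ \oo -->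
    series (weighted_sq (u k - x)) M.
  elim: M => [|M IH].
    rewrite (_ : (fun l => _) = cst 0); last by apply/funext => l;
      rewrite seriesEord /= big_ord0.
    by rewrite seriesEord /= big_ord0; exact: cvg_cst.
  rewrite (_ : (fun l => _) = (fun l =>
    series (weighted_sq (u k - u l)) M + weighted_sq (u k - u l) M)).
    by rewrite seriesSr; apply: cvgD.
  by apply/funext => l; rewrite seriesSr.
have bound e : 0 < e -> exists N, forall k, (N <= k)%N -> forall M,
    series (weighted_sq (u k - x)) M <= e.
  move=> e0; have [N hN] := uc _ e0; exists N => k Nk M.
  have := sum_cvg k M; rewrite -(cvg_shiftn N) => /cvgn_le_cst; apply => l.
  have hkl := lin_closedB hS (hu k) (hu (l + N)%N).
  apply: le_trans (series_le_limit M (weighted_sq_ge0 _) (H2_qform hkl)) _.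
  by apply: hN => //; apply: leq_addl.
have hux e : 0 < e -> exists N, forall k, (N <= k)%N ->
    H2 w (u k - x) /\ qform (H2inner w) (u k - x) <= e.
  move=> e0; have [N hN] := bound e e0; exists N => k Nk.
  have hk : H2 w (u k - x).
    apply/H2P; split; first by rewrite !fctE /= subr0; case: (hu k).
    apply: (@nonneg_series_is_cvg _ _ e); first exact: weighted_sq_ge0.
    exact: hN.
  by split=> //; apply: (cvgn_le_cst (H2_qform hk)); apply: hN.
exists x.
  have [N hN] := hux 1 ltr01; have [h _] := hN N (leqnn _).
  have -> : x = u N - (u N - x) by rewrite opprB addrC subrK.
  exact: lin_closedB.
by move=> e /hux[N hN]; exists N => k /hN[].
Qed.

Lemma H2_hilbert : hilbert_subspace (H2 w : set (nat -> R[i])) (H2inner w).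
Proof.
split; [exact: H2_lin_closed|exact: H2inner_psd|exact: H2_definite|exact:
  H2_complete].
Qed.

Lemma H2norm_qform x : H2 w x -> H2norm w x = Num.sqrt (qform (H2inner w) x).
Proof. by move=> hx; rewrite /H2norm (ereal_weighted_sum (H2_qform hx)). Qed.

Lemma compact_on_H2_operator (T : (nat -> R[i]) -> (nat -> R[i])) :
  compact_on_H2 w T -> compact_operator (H2 w : set (nat -> R[i])) (H2inner w) T.
Proof.
move=> [[TH Tl] Tc]; split=> // u hu.
have /Tc [phi [y [phiS hy cy]]] : forall k, H2 w (u k) /\ H2norm w (u k) <= 1.
  move=> k; have [h q1] := hu k; split=> //.
  by rewrite H2norm_qform // -sqrtr1 ler_sqrt.
exists phi, y; split=> // e e0.
have se0 : 0 < Num.sqrt e by rewrite sqrtr_gt0.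
have /cvgr0Pnorm_le /(_ _ se0) [N _ hN] := cy.
exists N => k Nk; have /= := hN k Nk.
have hk : H2 w (T (u (phi k)) - y).
  by apply: (lin_closedB H2_lin_closed) => //; apply: TH; case: (hu (phi k)).
rewrite (H2norm_qform hk) ger0_norm ?sqrtr_ge0 // ler_sqrt //.
exact: ltW.
Qed.

(** Transports a basis of each eigenspace, of dimension m, along a bijection
    with the m indices at which the singular value is taken. *)
Lemma eigenvector_family (T : (nat -> R[i]) -> (nat -> R[i])) (s : nat -> R) :
  singular_values w T s -> exists E : nat -> nat -> R[i],
  (forall k, 0 < s k -> gram_eigenspace w T (s k ^+ 2) (E k)) /\
  (forall t x, 0 < t -> gram_eigenspace w T (t ^+ 2) x ->
     (forall k, s k = t -> H2inner w x (E k) = 0) -> x = 0).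
Proof.
move=> [_ _ hs]; have hS := H2_lin_closed; have hB := H2inner_psd.
have /choice [B hBt] : forall t : R, exists Bt : nat -> nat -> R[i], 0 < t ->
  (forall k, s k = t -> gram_eigenspace w T (t ^+ 2) (Bt k)) /\
  (forall x, gram_eigenspace w T (t ^+ 2) x ->
     (forall k, s k = t -> H2inner w x (Bt k) = 0) -> x = 0).
  move=> t; have [t0|nt] := ltP 0 t; last by exists (fun=> 0).
  have [m /card_set_bijP[f [f1 f2 f3]] [e [eE _ espan]]] := hs t t0.
  exists (fun k => if insub (f k) is Some j then e j else 0) => _;
    split=> [k sk|x ex ox].
    by case: insubP => [j _ _|]; [exact: eE|rewrite f1].
  have [c xE] := espan x ex.
  have xs : x = \sum_(j < m) c j *: e j.
    apply/funext => n; rewrite xE.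
    elim/big_ind2: _ => // a b a' b' h1 h2; by rewrite h1 h2.
  have hx : H2 w x by case: ex.
  have he j : H2 w (e j) by case: (eE j).
  apply: H2_definite => //; rewrite /qform {1}xs (psd_form_suml hS hB) // big1
    // => j _.
  have [k sk fk] := f3 j (ltn_ord j).
  have := ox k sk; rewrite fk valK => xe.
  by rewrite (psd_formC hB hx (he j)) xe conjc0 mulr0.
exists (fun k => B (s k) k); split=> [k sk|t x t0 ex ox].
  by have [h _] := hBt _ sk; apply: h.
have [_ h] := hBt _ t0; apply: h => // k sk.
by have := ox k sk; rewrite sk.
Qed.

End SequenceSpace.

(** * Test functions for the Volterra operator *)

Section PolynomialsOnFrequencies.
Variables (R : realType) (w : nat -> R).
Hypothesis w0 : forall n, (0 < n)%N -> 0 < w n.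
Variables (N : nat) (kappa : 'I_N -> nat).
Hypotheses (kappa_inj : injective kappa) (kappa_gt0 : forall j, (0 < kappa j)%N).

Definition dirac_seq (k : nat) : nat -> R[i] := fun n => (n == k)%:R.

Definition dirichlet_poly (c : 'I_N -> R[i]) : nat -> R[i] :=
  \sum_j c j *: dirac_seq (kappa j).

Lemma dirichlet_polyE c n : dirichlet_poly c n = \sum_j c j * (n == kappa j)%:R.
Proof.
rewrite /dirichlet_poly; elim/big_ind2: _ => // a b a' b' h1 h2;
  by rewrite -h1 -h2.
Qed.

Lemma dirichlet_poly_at c j : dirichlet_poly c (kappa j) = c j.
Proof.
rewrite dirichlet_polyE (bigD1 j) //= eqxx mulr1 big1 ?addr0 // => k kj.
by rewrite (inj_eq kappa_inj) eq_sym (negbTE kj) mulr0.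
Qed.

Lemma dirichlet_poly_off c n : (forall j, n != kappa j) -> dirichlet_poly c n = 0.
Proof.
by move=> nk; rewrite dirichlet_polyE big1 // => j _;
  rewrite (negbTE (nk j)) mulr0.
Qed.

Lemma sum_injective_le (F : nat -> R) M : (forall n, 0 <= F n) ->
  (forall j, (kappa j <= M)%N) ->
  \sum_j F (kappa j) <= \sum_(n < M) F n.+1.
Proof.
move=> F0 kM; have -> : \sum_(n < M) F n.+1 = \sum_(1 <= n < M.+1) F n.
  by rewrite big_add1 /= big_mkord.
have -> : \sum_j F (kappa j) = \sum_(n <- [seq kappa j | j <- enum 'I_N]) F n.
  by rewrite big_map big_enum.
rewrite (perm_big [seq n <- index_iota 1 M.+1 | n \in [seq kappa j | j <- enum
  'I_N]]) /=.
  rewrite big_filter big_mkcond /=; apply: ler_sum => n _; by case: ifP.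
apply: uniq_perm.
- by rewrite map_inj_uniq ?enum_uniq.
- by rewrite filter_uniq // iota_uniq.
move=> n; rewrite mem_filter; case nk: (n \in _) => //=; symmetry.
by move/mapP: nk => [j _ ->]; rewrite mem_index_iota kappa_gt0 ltnS kM.
Qed.

Lemma dirac_seq_H2 j : H2 w (dirac_seq (kappa j)).
Proof.
apply/(H2P w0); split; first by rewrite /dirac_seq eq_sym gtn_eqF ?kappa_gt0.
apply: (@nonneg_series_is_cvg _ _ (w (kappa j))^-1) => [n|n];
  first exact: weighted_sq_ge0.
rewrite seriesEord /=.
have -> : (w (kappa j))^-1 = \sum_(k < (maxn n (kappa j))) (if k.+1 == kappa j
  then (w (kappa j))^-1 else 0).
  have kp := prednK (kappa_gt0 j).
  have jm : ((kappa j).-1 < maxn n (kappa j))%N by rewrite kp leq_maxr.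
  rewrite (bigD1 (Ordinal jm)) //= kp eqxx big1 ?addr0 // => k /eqP kj.
  case: eqP => // e; case: kj; apply: val_inj; exact: (congr1 predn e).
rewrite -(big_mkord xpredT (weighted_sq w (dirac_seq (kappa j)))).
rewrite -(big_mkord xpredT (fun k =>
  if k.+1 == kappa j then (w (kappa j))^-1 else 0)).
rewrite [leRHS](@big_cat_nat _ _ _ n) ?leq_maxl //=.
apply: ler_wpDr; first by apply: sumr_ge0 => k _; case: ifP => // _;
  rewrite invr_ge0 ltW // w0.
apply: ler_sum => k _; rewrite /weighted_sq /dirac_seq; case: eqP => [->|_].
  by rewrite /sqnorm /= expr1n expr0n addr0 mul1r.
by rewrite /sqnorm /= expr0n addr0 mul0r.
Qed.

Lemma dirichlet_poly_H2 c : H2 w (dirichlet_poly c).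
Proof. by apply: lin_closed_sum (H2_lin_closed w0) _ => j;
  apply: dirac_seq_H2. Qed.

Lemma dirichlet_poly_qform c :
  qform (H2inner w) (dirichlet_poly c) <= \sum_j sqnorm (c j) / w (kappa j).
Proof.
apply: (cvgn_le_cst (H2_qform w0 (dirichlet_poly_H2 c))) => n;
  rewrite seriesEord /=.
have e k : weighted_sq w (dirichlet_poly c) k =
    \sum_j (if k.+1 == kappa j then sqnorm (c j) / w (kappa j) else 0).
  rewrite /weighted_sq; have [[j kj]|nk] := pselect (exists j, k.+1 = kappa j).
    rewrite kj dirichlet_poly_at (bigD1 j) //= eqxx big1 ?addr0 // => l lj.
    by rewrite (inj_eq kappa_inj) eq_sym (negbTE lj).
  have nk' j : k.+1 != kappa j by apply/eqP => h; apply: nk; exists j.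
  rewrite dirichlet_poly_off // big1 => [|j _]; last by rewrite (negbTE (nk' j)).
  by rewrite /sqnorm /= expr0n addr0 mul0r.
under eq_bigr do rewrite e.
rewrite exchange_big /=; apply: ler_sum => j _.
have a0 : 0 <= sqnorm (c j) / w (kappa j) by rewrite divr_ge0 ?sqnorm_ge0 //
  ltW // w0.
have [jn|nj] := ltnP (kappa j).-1 n.
  rewrite (bigD1 (Ordinal jn)) //= prednK // eqxx big1 ?addr0 // => k /eqP kj.
  by case: eqP => // h; case: kj; apply: val_inj; exact: (congr1 predn h).
rewrite big1 // => k _; case: eqP => // h; have := ltn_ord k.
by rewrite ltnNge; move: nj; rewrite -h /= => ->.
Qed.

Lemma qform_ge_sum x : H2 w x ->
  \sum_j sqnorm (x (kappa j)) / w (kappa j) <= qform (H2inner w) x.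
Proof.
move=> hx; pose M := (\max_j kappa j)%N.
pose F n := if n is k.+1 then weighted_sq w x k else 0.
have F0 n : 0 <= F n by case: n => // n; apply: weighted_sq_ge0.
apply: le_trans (series_le_limit M (weighted_sq_ge0 w0 x) (H2_qform w0 hx)).
rewrite seriesEord /=; apply: le_trans (sum_injective_le F0 _); last first.
  by move=> j; apply: (leq_bigmax j).
rewrite le_eqVlt; apply/orP; left; apply/eqP; apply: eq_bigr => j _.
by rewrite -{1 2}(prednK (kappa_gt0 j)) /F -{3}(prednK (kappa_gt0 j)).
Qed.

End PolynomialsOnFrequencies.

(** The integers 1 + m (N + j), j < N, are prime to m and lie in an interval
    too short to contain a proper multiple of one of them. *)
Definition frequency (m N j : nat) : nat := (m * (N + j)).+1.

Lemma frequency_inj m N : (0 < m)%N -> injective (frequency m N).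
Proof. by move=> m0 j k [] /eqP; rewrite eqn_pmul2l // eqn_add2l => /eqP. Qed.

Lemma frequency_coprime m N j : coprime (frequency m N j) m.
Proof. by rewrite /frequency coprime_sym /coprime -addn1 mulnC gcdnMDl gcdn1. Qed.

(** The factor m can be cancelled by coprimality; a quotient at least 2 is
    excluded by size. *)
Lemma frequency_dvd m N j l : (0 < m)%N -> (j < N)%N -> (l < N)%N ->
  (frequency m N l %| m * frequency m N j)%N -> l = j.
Proof.
move=> m0 jN lN; rewrite Gauss_dvdr ?frequency_coprime // => /dvdnP[[|[|q]] e].
- by [].
- by apply: (frequency_inj (N := N) m0); rewrite e mul1n.
suff : (frequency m N j < frequency m N l + frequency m N l)%N.
  rewrite ltnNge e !mulSn addnA leq_addr //.
have h : (m * (N + j) <= m * (N + l) + m * (N + l))%N.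
  rewrite -mulnDr leq_mul2l addnACA; apply/orP; right.
  by rewrite (leq_trans _ (leq_addr _ _)) // leq_add2l ltnW.
by rewrite /frequency addSn addnS !ltnS.
Qed.

Section VolterraLowerBound.
Variables (R : realType) (w : nat -> R).
Hypothesis w0 : forall n, (0 < n)%N -> 0 < w n.
Hypothesis wM : forall k m, (0 < k)%N -> (0 < m)%N -> coprime k m ->
  w (k * m)%N = w k * w m.
Variables (b : nat -> R[i]) (m N : nat).
Hypotheses (m2 : (1 < m)%N) (N0 : (0 < N)%N) (bm : b m != 0).
Hypothesis TH : forall x, H2 w x -> H2 w (volterra b x).

Let m0 : (0 < m)%N. Proof. exact: ltnW. Qed.
Let kappa (j : 'I_N) := frequency m N j.
Let kappa_inj : injective kappa.
Proof. by move=> j l /(frequency_inj m0) h; apply: val_inj. Qed.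
Let kappa_gt0 j : (0 < kappa j)%N. Proof. by []. Qed.

(** By [frequency_dvd] the divisor sum at m k_j has the single term k = k_j. *)
Lemma volterra_at_frequency c j :
  volterra b (dirichlet_poly kappa c) (m * kappa j)%N =
  (ln m%:R / ln (m * kappa j)%N%:R)%:C * (c j * b m).
Proof.
rewrite /volterra (big_rem (kappa j)) /=; last first.
  by rewrite mem_index_iota kappa_gt0 /= ltn_Pmull.
rewrite dvdn_mull // mulnK // dirichlet_poly_at // big_seq_cond big1 ?addr0 =>
  [|k].
  by rewrite rmorphM /=; ring.
rewrite mem_rem_uniq ?iota_uniq // inE mem_index_iota =>
  /andP[/andP[kj /andP[k0 _]] kd].
rewrite dirichlet_poly_off ?mul0r // => l; apply: contra kj => /eqP kl.
move: kd; rewrite kl => /(frequency_dvd m0 (ltn_ord j) (ltn_ord l)) => lj.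
by rewrite /kappa lj.
Qed.

Definition volterra_bound : R :=
  ln m%:R / ln (2 * m ^ 2 * N)%N%:R * Num.sqrt (sqnorm (b m) / w m).

(** The coefficients of the image at the indices m k_j alone give the bound:
    log (m k_j) <= log (2 m^2 N), and w(m k_j) = w(m) w(k_j) by coprimality. *)
Lemma volterra_poly_lower_bound c :
  volterra_bound ^+ 2 * qform (H2inner w) (dirichlet_poly kappa c) <=
  qform (H2inner w) (volterra b (dirichlet_poly kappa c)).
Proof.
have hP := dirichlet_poly_H2 w0 kappa_gt0 c.
pose mk j := (m * kappa j)%N.
have mk_inj : injective mk.
  by move=> j l /eqP; rewrite eqn_pmul2l // => /eqP /kappa_inj.
have mk0 j : (0 < mk j)%N by rewrite muln_gt0 m0.
apply: le_trans (qform_ge_sum w0 mk_inj mk0 (TH hP)).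
apply: le_trans (ler_wpM2l (sqr_ge0 _) (dirichlet_poly_qform w0 kappa_inj
  kappa_gt0 c)) _.
rewrite mulr_sumr; apply: ler_sum => j _.
rewrite /mk volterra_at_frequency !sqnormM sqnorm_real wM //; last first.
  by rewrite coprime_sym frequency_coprime.
have lnm : 0 < ln m%:R :> R by rewrite ln_gt0 // ltr1n.
have wm := w0 m0; have wk := w0 (kappa_gt0 j).
have mk1 : (1 < m * kappa j)%N by apply: leq_trans m2 _; rewrite leq_pmulr.
have le_mk : (m * kappa j <= 2 * m ^ 2 * N)%N.
  rewrite expnS expn1 mulnA -mulnA [(2 * m)%N]mulnC -mulnA leq_mul2l;
    apply/orP; right.
  rewrite /kappa /frequency.
  apply: (@leq_trans (m * (N + j).+1)%N).
    by rewrite mulnS -add1n leq_add2r.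
  rewrite mulnA [(2 * m)%N]mulnC -mulnA leq_mul2l; apply/orP; right.
  by rewrite mul2n -addnn -addnS leq_add2l ltn_ord.
have ln1 : 0 < ln (m * kappa j)%N%:R :> R by rewrite ln_gt0 // ltr1n.
have ln2 : ln (m * kappa j)%N%:R <= ln (2 * m ^ 2 * N)%N%:R :> R.
  by rewrite ler_ln ?posrE ?ltr0n ?ler_nat // ?muln_gt0 ?expn_gt0 ?m0.
have ln3 : 0 < ln (2 * m ^ 2 * N)%N%:R :> R by apply: lt_le_trans ln2.
rewrite /volterra_bound exprMn sqr_sqrtr;
  last by rewrite divr_ge0 ?sqnorm_ge0 ?ltW.
have -> : (ln m%:R / ln (m * kappa j)%N%:R) ^+ 2 * (sqnorm (c j) * sqnorm (b
  m)) / (w m * w (kappa j))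
  = (ln m%:R / ln (m * kappa j)%N%:R) ^+ 2 * (sqnorm (b m) / w m) * (sqnorm (c
    j) / w (kappa j)).
  by rewrite invfM; ring.
apply: ler_wpM2r; first by rewrite divr_ge0 ?sqnorm_ge0 ?ltW.
apply: ler_wpM2r; first by rewrite divr_ge0 ?sqnorm_ge0 ?ltW.
apply: lerXn2r; rewrite ?nnegrE ?divr_ge0 //; try exact: ltW.
by rewrite ler_pM2l // lef_pV2.
Qed.

Lemma volterra_bound_gt0 : 0 < volterra_bound.
Proof.
rewrite /volterra_bound mulr_gt0 ?divr_gt0 ?ln_gt0 ?ltr1n ?sqrtr_gt0 //.
  by rewrite -mulnA (@leq_pmulr 2) // muln_gt0 expn_gt0 m0.
by rewrite divr_gt0 ?w0 ?sqnorm_gt0.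
Qed.

End VolterraLowerBound.

(** With e = 1/(2p), ln y <= y^e / e, so the left-hand side is at least a
    constant times N (a N)^(-1/2); taking N = M^2 this is a constant times M. *)
Lemma log_power_unbounded (R : realType) (K p S : R) (a : nat) :
  0 < K -> 0 < p -> (1 < a)%N ->
  ~ (forall N, (0 < N)%N -> N%:R * (K / ln (a * N)%N%:R) `^ p <= S).
Proof.
move=> K0 p0 a1 h.
have p20 : 0 < 2 * p by rewrite mulr_gt0.
pose e := (2 * p)^-1; have e0 : 0 < e by rewrite invr_gt0 mulr_gt0.
pose A := Num.sqrt (a%:R : R); have A0 : 0 < A by rewrite sqrtr_gt0 ltr0n ltnW.
pose B := (K * e) `^ p; have B0 : 0 < B by rewrite powR_gt0 // mulr_gt0.
suff main M : (0 < M)%N -> M%:R <= S * A / B.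
  have := archi_boundP (normr_ge0 (S * A / B)); set n := Num.bound _ => hn.
  have n0 : (0 < n)%N by rewrite -(ltr0n R); apply: le_lt_trans hn.
  by have := le_lt_trans (le_trans (main n n0) (ler_norm _)) hn; rewrite ltxx.
move=> M0; have M0' : 0 < M%:R :> R by rewrite ltr0n.
have MM : (0 < M * M)%N by rewrite muln_gt0 M0.
have := h _ MM; set y : R := (a * (M * M))%N%:R.
have y1 : 1 < y.
  by rewrite ltr1n; apply: leq_trans a1 _; rewrite leq_pmulr.
have y0 : 0 < y by lra.
have lny : 0 < ln y by rewrite ln_gt0.
have ye0 : 0 < y `^ e by rewrite powR_gt0.
have le1 : K * e / y `^ e <= K / ln y.
  rewrite -mulrA ler_pM2l // -[leRHS]mul1r ler_pdivlMr // mulrAC ler_pdivrMr //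
    mul1r.
  by have := ln_sublinear ye0; rewrite ln_powR => /ltW.
have le2 : B / (A * M%:R) <= (K / ln y) `^ p.
  have -> : B / (A * M%:R) = (K * e / y `^ e) `^ p.
    rewrite powRM ?mulr_ge0 ?invr_ge0 ?ltW // -/B; apply: (congr1 ( *%R B)).
    rewrite -powRN -powRrM.
    have -> : - e * p = - (2^-1).
      by rewrite /e invfM mulNr mulfVK // gt_eqF.
    rewrite powRN powR12_sqrt ?ltW // /y natrM sqrtrM // natrM.
    by rewrite -expr2 sqrtr_sqr ger0_norm.
  by apply: (ge0_ler_powR (ltW p0) _ _ le1);
    rewrite nnegrE divr_ge0 ?mulr_ge0 // ltW.
move=> hS; have {}hS := le_trans (ler_wpM2l (ler0n _ (M * M)) le2) hS.
have e1 : (M * M)%:R * (B / (A * M%:R)) = M%:R * B / A.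
  rewrite natrM; field.
  by rewrite !gt_eqF.
by move: hS; rewrite e1 ler_pdivrMr // -ler_pdivlMr.
Qed.

Lemma schatten_term_bound (R : realType) (s : nat -> R) (p : R) : 0 < p ->
  (forall n, 0 <= s n) -> (forall n, s n.+1 <= s n) ->
  cvgn (series (fun n => s n `^ p)) ->
  exists S, forall n d, 0 <= d -> d <= s n -> n.+1%:R * d `^ p <= S.
Proof.
move=> p0 s0 sS /cvg_ex[S hS]; exists S => n d d0 dn.
have t0 k : 0 <= s k `^ p by apply: powR_ge0.
apply: le_trans (series_le_limit n.+1 t0 hS); rewrite seriesEord /=.
rewrite mulr_natl -[X in _ *+ X]card_ord -sumr_const.
apply: ler_sum => k _; apply: (ge0_ler_powR (ltW p0)); rewrite ?nnegrE //.
by apply: le_trans dn _; apply: ((nonincreasing_seqP s).1 sS); rewrite -ltnS.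
Qed.

Theorem theorem4 (R : realType) (w : nat -> R) (hw : weight_class w)
  (b : nat -> R[i]) (hb : forall n : nat, (n < 2)%N -> b n = 0)
  (hg : exists n : nat, b n <> 0) (p : R) (hp : 0 < p) :
  ~ schatten w p (volterra b).
Proof.
move=> [hc [s hs scvg]]; have [m /eqP bm] := hg.
have w0 n : (0 < n)%N -> 0 < w n by apply: weight_class_gt0.
have wM := weight_class_coprimeM hw.
have m2 : (1 < m)%N by rewrite ltnNge; apply: contra bm => /hb/eqP.
have TH x : H2 w x -> H2 w (volterra b x) by case: hc => [[h _] _]; apply: h.
have hT := compact_on_H2_operator w0 hc.
have [E [hE spec]] := eigenvector_family w0 hs.
have [s_ge0 sS _] := hs.
have [S hS] := schatten_term_bound hp s_ge0 sS scvg.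
have low n : volterra_bound w b m n.+1 <= s n.
  have fi : injective (fun j : 'I_n.+1 => frequency m n.+1 j).
    by move=> j l /(frequency_inj (ltnW m2)) h; apply: val_inj.
  apply: (singular_value_lower_bound (H2_hilbert w0) hT sS
    (v := fun j => dirac_seq R (frequency m n.+1 j)) (E := E)).
  - by move=> k sk; have [h1 [_ h2]] := hE k sk.
  - move=> t x t0 hx ex ox; apply: (spec t) => //; split=> //; split=> //.
    exact: (lin_closedZ _ (H2_lin_closed w0) hx).
  - exact: volterra_bound_gt0.
  - by move=> j; apply: (dirac_seq_H2 w0 (kappa := fun j : 'I_n.+1 =>
    frequency m n.+1 j)).
  - move=> c c0 j; rewrite -(dirichlet_poly_at fi c j).
    by rewrite /dirichlet_poly c0.
  - by move=> c; apply: volterra_poly_lower_bound.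
pose K := ln m%:R * Num.sqrt (sqnorm (b m) / w m).
have K0 : 0 < K.
  have lnm : 0 < ln m%:R :> R by rewrite ln_gt0 // ltr1n.
  by apply: mulr_gt0 => //; rewrite sqrtr_gt0 divr_gt0 ?sqnorm_gt0 // w0 // ltnW.
apply: (@log_power_unbounded R K p S (2 * m ^ 2) K0 hp).
  by rewrite -[1%N]muln1; apply: ltn_mul => //; rewrite -(expn0 m) ltn_exp2l.
case=> // n _; have := hS n (volterra_bound w b m n.+1) _ (low n).
rewrite /volterra_bound mulrAC; apply; rewrite -mulrAC.
by apply: ltW; apply: volterra_bound_gt0.
Qed.
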